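(* If $G$ is an admissible graph on $n$ vertices, then $f(G)\ge \frac{1}{27}+o(1)$, where $o(1)\to 0$ as $n\to\infty$.
   Context: For a permutation $\tau$ of $[n]$, its representation graph has vertex set $[n]$, with $ij$ ($i<j$) an edge iff $\tau(i)>\tau(j)$. A graph on $n$ vertices is admissible if it is isomorphic to the representation graph of some permutation of $[n]$. For graphs $H$ on $l$ vertices and $G$ on $n$ vertices, $P(H,G)$ is the number of $l$-subsets $U\subseteq V(G)$ with $G[U]\cong H$, and $p(H,G)=P(H,G)/\binom{n}{l}$. Define $f(G)=p(K_4,G)+p(\overline{K_4},G)$, where $\overline{K_4}$ is the empty graph on 4 vertices. *)

(* Defs.v *)
From mathcomp Require Import all_boot all_order all_algebra all_fingroup.
Set Implicit Arguments. Unset Strict Implicit. Unset Printing Implicit Defensive.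
Import Order.TTheory GRing.Theory Num.Theory.

Definition perm_graph (n : nat) (tau : 'S_n) : rel 'I_n :=
  fun i j => ((i < j) && (tau j < tau i)) || ((j < i) && (tau i < tau j)).

Definition admissible (n : nat) (G : rel 'I_n) : Prop :=
  exists (tau : 'S_n) (sigma : 'S_n),
    forall i j, G i j = perm_graph tau (sigma i) (sigma j).

Definition induced_iso (l n : nat) (H : rel 'I_l) (G : rel 'I_n)
    (U : {set 'I_n}) : bool :=
  [exists f : {ffun 'I_l -> 'I_n},
     injectiveb f && (f @: setT == U) &&
     [forall a, forall b, H a b == G (f a) (f b)]].

Definition Pcount (l n : nat) (H : rel 'I_l) (G : rel 'I_n) : nat :=
  #|[set U : {set 'I_n} | (#|U| == l) && induced_iso H G U]|.

Definition pdens (l n : nat) (H : rel 'I_l) (G : rel 'I_n) : rat :=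
  ((Pcount H G)%:R / ('C(n, l))%:R)%R.

Definition K4 : rel 'I_4 := fun a b => a != b.
Definition empty4 : rel 'I_4 := fun _ _ => false.

Definition fval (n : nat) (G : rel 'I_n) : rat :=
  (pdens K4 G + pdens empty4 G)%R.

(* Main.v *)
Require Import Defs.
From Stdlib Require Import ZArith.
From mathcomp Require Import all_boot all_order all_algebra all_fingroup.
From mathcomp Require Import ssrZ zify lra.

(** Flag algebra method. Sample seven points of the permutation. A flag is a small
    configuration seen from some labelled points, and for weights [w] on flags the
    square of the [w]-weighted number of ways to extend the labelled points is
    nonnegative. Two families of labelled configurations suffice: pairs of points in
    increasing position, extended by two further points, and patterns of size five,
    extended by one further point (which lies in one of the 36 cells of the grid cut
    out by the five points). Averaging such squares over the eight symmetries of the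
    square and over all placements of the labelled points in a permutation [q] of
    seven points gives a number [S q], up to an error caused by coinciding points.
    With the weights below (a rounded solution of a semidefinite program),
    [F q / 35 >= 1/27 + S q] for all 5040 permutations [q], where [F q] counts the
    monotone 4-subsequences of [q]; since the average of [S] is nonnegative up to
    O(1/n), so is the average of [F q / 35 - 1/27].

    In the limit, equality holds only for three layers of equal size, so the inequality
    is tight for all [q] with at most three layers. It is also tight for some [q] obtained
    from them by moving one point of a layer slightly into a neighbouring one, because
    the corresponding perturbations of the extremal example increase the density only to
    fourth order. Hence the rounding must be exact on these [q], 376 in total. *)

Set Implicit Arguments. Unset Strict Implicit. Unset Printing Implicit Defensive.
Import Order.TTheory GRing.Theory Num.Theory.
(* [ssrint] delimits [int_scope] with [Z]. *)
Local Delimit Scope Z_scope with Z.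

(** * The certificate *)

(* Weights are integers in the scale [scale]. The first component of [pair_flags] lists
   the coefficients of the squares; the rows of the second component list the weights of
   a flag in each of them, a flag being indexed as in [pair_flag] below. [cell_flags]
   does the same for each of the 19 labelled patterns in use, with rows indexed by
   cells. Absent rows are zero. *)
Definition scale : Z := 21069103104000%Z.

Definition pair_flags : seq Z * seq (seq Z) :=
  ([:: 5760; 5760; 5760; 42598772640; 38104991220; 51525759960; 41710472640],
   [::
     [:: 11421; 9750; -3765; 0; 0; 1; 0]; [:: -124060; -56368; 41762; 0; 0; 0; 0];
     nil; [:: -30914; 17030; -10584; 0; -1; 0; 0]; nil;
     [:: -47207; 31398; 7718; 0; 0; 0; 0]; [:: -14176; 13152; -8905; 0; 0; 0; 0];
     [:: -16592; 15714; -8988; 0; -1; 0; 0]; nil;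
     [:: -76750; -25598; 19316; 0; 0; 0; -2]; nil;
     [:: -47599; 3031; -3836; 0; 1; -1; 0]; [:: 11077; 45532; -1662; 0; 0; 0; 0];
     [:: -13178; 28269; 11509; 0; 0; 0; 0]; nil;
     [:: -33279; 1715; -2240; 0; 1; -1; 0]; nil;
     [:: -42924; 7192; 10890; 0; 0; 0; 0]; [:: -59614; 17329; -13968; 0; 0; 0; 0];
     nil; [:: 151757; 0; 0; 0; 1; 0; 0]; [:: -282; 54076; -24607; 0; 0; 0; 0]; nil;
     [:: 27076; -35177; -7171; 0; 0; 0; 0]; [:: 123113; 2632; -3192; 0; 1; 0; 0];
     nil; [:: -83269; 1944; -2745; 0; 0; 0; 1];
     [:: -55271; 8499; -7650; 1; 0; 0; 0]; nil;
     [:: -7196; -41594; 20390; 0; 0; 0; 0]; [:: 89317; -36; 2568; 0; 0; 0; 0]; nil;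
     [:: 8287; -29478; 18135; 0; 0; 0; 0]; [:: 7124; -42910; 21986; 0; 0; 0; 0];
     nil; [:: -10630; 32920; -18302; 0; -1; 0; 0];
     [:: 8164; 45800; -1986; 0; 0; 0; 0]; nil; [:: 86404; 232; 2244; 0; 0; 0; 0];
     nil; [:: 13502; -29968; -8545; 0; 0; 0; 0];
     [:: 32200; -33448; -8364; 0; 0; 0; 0]; [:: 57760; 2864; -948; 0; 0; 0; 0];
     nil; [:: -15491; 30415; 9237; 0; 0; 0; 1]; nil;
     [:: -26424; -1468; 7832; 0; 0; 0; 0]; [:: 74450; -56194; -156; 0; 0; 0; 0];
     [:: 16415; -30236; -8221; 0; 0; 0; 0]; nil;
     [:: -55064; 1164; 4640; 0; 0; 0; 0]; nil;
     [:: -32404; 14020; 13450; 0; 0; 0; 0]; [:: -26923; 47288; 0; 0; 0; 0; 0]; nil;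
     nil; nil; nil; nil; nil; [:: 94469; 5264; -6384; 0; 1; 0; 0];
     [:: -45720; 58253; -29670; 0; 0; 0; 0]; nil;
     [:: -40949; 7183; -6054; 1; 0; 0; 0]; nil;
     [:: 7126; -42910; 21986; 0; 0; 0; 0]; [:: 60673; 2596; -624; 0; 0; 0; 0];
     [:: 4456; -33096; -9690; 0; 0; 0; 0]; nil;
     [:: 21446; -44226; 23582; 0; 0; 0; 0]; nil;
     [:: 3692; 31604; -16706; 0; -1; 0; 0]; nil; nil; nil; nil; nil; nil;
     [:: -37831; -2233; 2318; 0; 0; 0; 1]; nil;
     [:: -35889; -21020; 18681; 0; 0; 1; 2]; [:: -29440; 5172; -3130; 0; 0; 0; -4];
     nil; [:: 413; 26947; -17993; -1; 0; -1; -1];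
     [:: -12578; 30147; 9561; 0; 0; 0; 1]; nil;
     [:: 27621; 20484; -10285; 0; 0; 0; 1];
     [:: 14733; 25631; -16397; -1; 0; -1; -1]; nil;
     [:: 4386; 37962; -11556; 0; 0; 0; -2]; nil; nil; nil; nil; nil; nil;
     [:: 8292; -29478; 18135; 0; 0; 0; 0]; nil;
     [:: -17815; 24661; -15348; 0; 0; 0; 1]; nil;
     [:: 8240; 33316; -8175; 0; -1; 1; 0]; [:: -65736; 31359; -12004; 0; 0; 0; 0];
     [:: -23511; -1736; 8156; 0; 0; 0; 0]; nil;
     [:: -20400; 35948; -11367; 0; -1; 1; 0]; nil;
     [:: -34728; 8266; -11135; 0; 0; 0; 0];
     [:: -27315; 18921; -11554; 0; 1; -1; 0]; nil; nil; nil; nil; nil; nil; nil;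
     nil; nil; nil; nil; nil; [:: 19328; -30504; -7897; 0; 0; 0; 0];
     [:: 20548; -32376; -9660; 0; 0; 0; 0]; nil;
     [:: 51828; -54113; -2675; 0; 0; 0; 0]; nil;
     [:: 7106; 44159; 3791; 0; 0; 0; 0]; nil; nil; nil; nil; nil; nil; nil; nil;
     nil; nil; nil; nil; [:: -52151; 896; 4964; 0; 0; 0; 0]; nil;
     [:: -49040; 38580; -14559; 0; -1; 1; 0];
     [:: -111172; 35536; -17067; 0; 0; 0; 0]; nil;
     [:: -12995; 17605; -9958; 0; 1; -1; 0]; nil; nil; nil; nil; nil; nil; nil;
     nil; nil; nil; nil; nil; [:: -29491; 13752; 13774; 0; 0; 0; 0]; nil;
     [:: 10708; 4089; -6072; 0; 0; 0; 0]; nil;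
     [:: -69715; -53810; 27107; 0; 0; 1; 0]; [:: 38212; 70752; -19982; 0; 0; 0; 0]])%Z.

Definition cell_flags : seq (seq nat * (seq Z * seq (seq Z))) := [::
  ([:: 0; 1; 2; 3; 4]%N,
   ([:: 5760; 42124945920],
    [::
      [:: 59056; -2]; [:: 57075; 0]; [:: 39306; 0]; [:: 12716; 0]; [:: -29528; 1];
      [:: -29528; 1]; [:: 57075; 0]; [:: 59056; -2]; [:: 3870; 0]; nil;
      [:: 4783; 0]; [:: -29528; 1]; [:: 39306; 0]; [:: 3870; 0]; [:: 59056; -2];
      nil; nil; [:: 12716; 0]; [:: 12716; 0]; nil; nil; [:: 59056; -2];
      [:: 3870; 0]; [:: 39306; 0]; [:: -29528; 1]; [:: 4783; 0]; nil; [:: 3870; 0];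
      [:: 59056; -2]; [:: 57075; 0]; [:: -29528; 1]; [:: -29528; 1]; [:: 12716; 0];
      [:: 39306; 0]; [:: 57075; 0]; [:: 59056; -2]])%Z);
  ([:: 0; 1; 2; 4; 3]%N,
   ([:: 5760],
    [::
      [:: 32882]; [:: 61177]; [:: -59125]; [:: -26008]; [:: 1848]; [:: -4210];
      [:: 61177]; [:: 33671]; [:: -8971]; [:: 6069]; [:: 10714]; [:: -28100];
      [:: -59125]; [:: -8971]; [:: 33371]; [:: 50702]; [:: 40313]; [:: -15641];
      [:: -26008]; [:: 6069]; [:: 50702]; [:: 19475]; [:: 20870]; [:: 54638];
      [:: 1848]; [:: 10714]; [:: 40313]; [:: 20870]; [:: 53598]; [:: 21725];
      [:: -4210]; [:: -28100]; [:: -15641]; [:: 54638]; [:: 21725]; [:: 356]])%Z);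
  ([:: 0; 1; 3; 4; 2]%N,
   ([:: 5760; 5760; 8764642120; 74138858552; 72878065464],
    [::
      [:: 24885; 60392; 0; 0; 0]; [:: 110915; -18913; 0; 0; 0];
      [:: -19774; 339; 0; 0; 0]; [:: 7027; 13645; 0; 0; 0];
      [:: 2491; 12927; 0; 0; 0]; [:: 907; -8149; 1; 0; 1]; [:: 122964; 0; 0; 0; 0];
      [:: 34557; 64832; 0; 0; 0]; [:: -35439; 63794; 0; 0; 0];
      [:: 8102; 9895; 0; 0; 0]; [:: -8954; 14021; 0; 0; 0];
      [:: -34679; -20290; 0; 0; 0]; [:: -87654; -32287; 0; 0; 0];
      [:: 8475; 57350; 0; 0; 0]; [:: 79671; 64690; 0; 0; 0];
      [:: 43935; 56899; -1; -1; 0]; [:: 27914; 11633; 0; 0; 0];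
      [:: 5578; 12190; 0; 0; 0]; [:: -56408; -29547; 0; 0; 0];
      [:: -67395; -41412; 0; 0; 0]; [:: 42830; 18448; 0; 0; 0];
      [:: 27541; 11490; 0; 0; 0]; [:: 43935; 56899; -1; -1; 0];
      [:: 66249; 57615; 0; 0; 0]; [:: -44842; -48750; 0; 1; -1];
      [:: -74904; 35363; 0; 0; 0]; [:: 9727; -27987; 0; 0; 0];
      [:: 18320; 26342; 0; 0; 0]; [:: 71796; 64073; 0; 0; 0];
      [:: 43935; 56899; -1; -1; 0]; [:: 907; -8149; 1; 0; 1];
      [:: -31408; -16005; 0; 0; 0]; [:: -4284; 39443; 0; 0; 0];
      [:: -3912; 19658; 0; 0; 0]; [:: 29981; 5559; 0; 0; 0]])%Z);
  ([:: 0; 1; 4; 3; 2]%N,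
   ([:: 5760; 59605095966],
    [::
      [:: 110; 0]; [:: -1771; 1]; [:: -1771; 1]; [:: 2386; 0]; [:: -9530; 0];
      [:: 1486; 0]; [:: -1771; 1]; [:: 868; 0]; [:: -1771; 1]; [:: -1771; 1];
      [:: -13867; 0]; [:: 3542; -2]; [:: -1771; 1]; [:: -1771; 1]; [:: 366; 0];
      [:: 5604; 0]; [:: -14369; 0]; [:: 3542; -2]; [:: 2386; 0]; [:: -1771; 1];
      [:: 5604; 0]; [:: 31481; 0]; [:: 3542; -2]; [:: -8838; 0]; [:: -9530; 0];
      [:: -13867; 0]; [:: -14369; 0]; [:: 3542; -2]; [:: 34625; 0]; [:: 277; 0];
      [:: 1486; 0]; [:: 3542; -2]; [:: 3542; -2]; [:: -8838; 0]; [:: 277; 0]])%Z);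
  ([:: 0; 2; 1; 4; 3]%N,
   ([:: 5760; 6379136474432; 393546463136],
    [::
      [:: 35327; 0; 0]; [:: -50392; 0; 1]; [:: -50392; 0; 1]; [:: 30041; 1; 0];
      [:: 13186; 0; 0]; [:: -7363; 0; 0]; [:: -50392; 0; 1]; [:: 54253; 0; 0];
      [:: 61851; 0; 0]; [:: 30041; 1; 0]; [:: 30041; 1; 0]; [:: -8752; 0; 0];
      [:: -50392; 0; 1]; [:: 61851; 0; 0]; [:: 30041; 1; 0]; [:: 38398; 0; 0];
      [:: 30295; 0; 0]; [:: 20351; -1; -1]; [:: 30041; 1; 0]; [:: 30041; 1; 0];
      [:: 38398; 0; 0]; [:: 6565; 0; 0]; [:: -10012; 0; 0]; [:: 20351; -1; -1];
      [:: 13186; 0; 0]; [:: 30041; 1; 0]; [:: 30295; 0; 0]; [:: -10012; 0; 0];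
      [:: 20351; -1; -1]; [:: 1503; 0; 0]; [:: -7363; 0; 0]; [:: -8752; 0; 0];
      [:: 20351; -1; -1]; [:: 20351; -1; -1]; [:: 1503; 0; 0]])%Z);
  ([:: 0; 2; 3; 1; 4]%N,
   ([:: 5760],
    [::
      nil; [:: 1421]; [:: -31012]; [:: -34131]; [:: 19877]; [:: -18029]; [:: 1209];
      nil; [:: -15285]; [:: -42941]; [:: -4488]; [:: -4792]; [:: 50396]; nil;
      [:: -56889]; [:: -21472]; [:: -9612]; [:: -17622]; [:: -3615]; [:: 2420];
      [:: -52149]; [:: -39323]; [:: -8213]; [:: -20009]; [:: -749]; [:: -42159];
      [:: 3799]; nil; nil; [:: -46362]; [:: -19350]; [:: -25119]; [:: 41934];
      [:: 77963]; [:: -48994]])%Z);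
  ([:: 0; 2; 3; 4; 1]%N,
   ([:: 5760; 5760; 5760; 61023429336; 21874490856],
    [::
      [:: 109908; -8310; -6718; 0; 0]; [:: -1240; 21787; -23088; 0; 0];
      [:: 9098; 31170; 17539; 0; 0]; [:: 25284; -6946; -5198; 0; 0];
      [:: 49217; 2087; 9514; 0; 0]; [:: 21372; -5710; -17003; 0; 1];
      [:: 40459; 21160; -45813; 0; 0]; [:: 112563; 0; 0; 0; 0];
      [:: 60978; 2661; 22495; -1; -1]; [:: 656; -2776; -22101; 0; 0];
      [:: 8552; -26230; -8147; 0; 0]; [:: -14916; -13057; 997; 0; 0];
      [:: -32995; -11281; 55268; 0; 0]; [:: 14705; 16788; -7962; 0; 0];
      [:: -3973; 9261; -9892; 0; 0]; [:: 60978; 2661; 22495; -1; -1];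
      [:: 11655; -22220; -15445; 0; 0]; [:: -29740; 14955; 16647; 0; 0];
      [:: -69172; -20262; -213; 0; 0]; [:: 36114; -40198; -27261; 0; 0];
      [:: 10751; -5474; 3275; 0; 0]; [:: 13730; -10668; -17194; 0; 0];
      [:: 60978; 2661; 22495; -1; -1]; [:: 12805; 59817; 3010; 0; 0];
      [:: -82350; 3049; -5492; 1; 0]; [:: 11450; -26579; -24949; 0; 0];
      [:: 32050; -44844; -31089; 0; 0]; [:: -5393; 6072; 51724; 0; 0];
      [:: -2517; 74872; 0; 0; 0]; [:: 60978; 2661; 22495; -1; -1];
      [:: 21372; -5710; -17003; 0; 1]; [:: -14716; -31769; -16703; 0; 0];
      [:: 266; -4759; -24998; 0; 0]; [:: 39348; -31067; 13999; 0; 0];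
      [:: 40124; 14785; -11966; 0; 0]; [:: 20181; -309; 2401; 0; 0]])%Z);
  ([:: 0; 2; 4; 1; 3]%N,
   ([:: 5760; 5760; 5760; 5760; 37560337146; 594659944022; 48091731794;
   28229452712],
    [::
      [:: 45777; 292; -2426; -366; 0; 0; 0; 0];
      [:: -62260; 6895; 52411; 8310; 1; 0; 1; 1];
      [:: -18545; 37868; 71376; 0; 0; 0; 0; 0];
      [:: -19685; -10831; -53079; 4939; 0; 0; 0; 0];
      [:: -16475; -7104; -18698; 6294; 0; 0; 0; 0];
      [:: -17682; 8096; -4552; -4693; 0; 0; 0; 0];
      [:: -62260; 6895; 52411; 8310; 1; 0; 1; 1];
      [:: 32610; -10197; -5778; -300; 0; 0; 0; 0];
      [:: 30579; -25826; -25091; -3401; 0; 0; 0; 0];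
      [:: 30516; 5697; -29944; 13152; 0; 1; -1; 0];
      [:: 55839; 1488; -27143; -3595; 0; 0; 0; 0];
      [:: -3941; 27431; -24289; -11109; 0; 0; 0; 0];
      [:: -20017; 86966; 0; 0; 0; 0; 0; 0]; [:: 123503; 0; 0; 0; 0; 0; 0; 0];
      [:: 30516; 5697; -29944; 13152; 0; 1; -1; 0];
      [:: 12972; -48150; -4234; 4326; 0; 0; 0; 0];
      [:: -14206; -71175; 34233; 5755; 0; 0; 0; 0];
      [:: -8311; -31437; -49930; -12442; 0; 0; 0; 0];
      [:: 32148; 65455; -11322; -1685; 0; 0; 0; 0];
      [:: 79197; 18915; -11183; 1859; 0; 0; 0; 0];
      [:: 44354; -10778; -23493; -27930; 0; 0; 0; 0];
      [:: 29017; -13113; 20580; 1836; 0; 0; 0; 0];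
      [:: -18700; -29565; -31923; 3095; 0; 0; 0; 0];
      [:: -16173; -56203; 11546; 8341; 0; 0; 0; 0];
      [:: -11271; 3193; -29443; -15667; 0; 0; 0; 0];
      [:: -6367; -34025; -44415; -21281; 0; 0; 0; 1];
      [:: -27242; -25675; -48565; 16685; 0; 0; 0; 0];
      [:: 3245; -3519; -7538; -4875; 0; 0; 0; 0];
      [:: 31744; -12592; -22467; -21462; -1; -1; 0; -1];
      [:: 18856; -42873; 58896; 31628; 0; 0; 0; 0];
      [:: -19262; -6658; -3663; -2003; 0; 0; 0; 0];
      [:: -7874; 5151; -21520; -6907; 0; 0; 0; 0];
      [:: 4667; -58645; -25841; -5260; 0; 0; 0; 0];
      [:: 31744; -12592; -22467; -21462; -1; -1; 0; -1];
      [:: 2069; -4007; -12362; -5187; 0; 0; 0; 0]])%Z);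
  ([:: 0; 2; 4; 3; 1]%N,
   ([:: 5760; 5760; 5760; 70103847488; 30090995024; 1303418592],
    [::
      [:: 21541; 43531; 16514; 0; 0; 0]; [:: 2599; -47331; -15505; 1; 0; 0];
      [:: 3867; -8563; 13925; 0; 0; 0]; [:: -14572; -3485; -50389; 0; 0; 0];
      [:: -5231; 33102; -9163; 0; 0; 0]; [:: 16576; -26587; 14194; 0; 0; 0];
      [:: 2599; -47331; -15505; 1; 0; 0]; [:: 1049; 73388; 0; 0; 0; 0];
      [:: -14742; 29284; 9234; 0; 0; 0]; [:: -23050; 25948; -52282; 0; 1; 0];
      [:: 39578; 16645; -17596; 0; 0; 0]; [:: 5128; -24285; 6847; 0; 0; 0];
      [:: -27306; -17005; -40069; 0; 0; 0]; [:: 9863; 9773; -2493; 0; 0; 1];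
      [:: -23050; 25948; -52282; 0; 1; 0]; [:: 16216; -6413; 25534; 0; 0; 0];
      [:: 93008; 0; 0; 0; 0; 0]; [:: -12462; 37558; 17998; -1; 0; -1];
      [:: -55510; 7725; -3246; 0; 0; 0]; [:: -3597; 30526; 10586; 0; 0; 0];
      [:: -37793; 1100; 15187; 0; 0; 0]; [:: -32962; -30945; 38341; 0; 0; 0];
      [:: -12462; 37558; 17998; -1; 0; -1]; [:: 53845; 13515; -18059; 0; 0; 0];
      [:: 2246; 26796; -24644; 0; 0; 0]; [:: 2058; 17709; -10745; 0; 0; 0];
      [:: 25823; 13803; 57057; 0; 0; 0]; [:: -12462; 37558; 17998; -1; 0; -1];
      [:: -65230; -22558; 28694; 0; 0; 0]; [:: 14015; 2605; 157; 0; 0; 0];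
      [:: 6627; -48677; 25632; 0; 0; 0]; [:: 725; 2454; 38470; 0; 0; 0];
      [:: 12822; 2644; -2818; 0; 0; 0]; [:: 20451; 21383; 67787; -1; -1; 0];
      [:: -23655; 21354; 20126; 0; 0; 0]; [:: 19427; 16200; 16689; 0; 0; 0]])%Z);
  ([:: 0; 3; 2; 1; 4]%N,
   ([:: 9951440356707; 425647573764],
    [::
      nil; [:: 1; 0]; [:: 1; 0]; nil; [:: 0; 1]; nil; [:: 1; 0]; nil; nil; nil;
      [:: 0; 1]; [:: 0; 1]; [:: 1; 0]; nil; nil; [:: 0; 1]; nil; nil; nil; nil;
      [:: 0; 1]; nil; nil; [:: -1; -1]; [:: 0; 1]; [:: 0; 1]; nil; nil; nil;
      [:: -1; -1]; nil; [:: 0; 1]; nil; [:: -1; -1]; [:: -1; -1]])%Z);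
  ([:: 0; 3; 2; 4; 1]%N,
   ([:: 5760; 5760; 27513848448; 32384368792; 41795749880],
    [::
      [:: 5516; -169; 0; 0; 0]; [:: -19664; 279; 0; 0; 1];
      [:: -7581; -37865; 0; 0; 0]; [:: 20975; 36379; 0; 0; 0];
      [:: 23335; 1128; 0; 0; 0]; [:: -3067; 423; 0; 0; 0];
      [:: -19664; 279; 0; 0; 1]; [:: 5516; -169; 0; 0; 0];
      [:: 26876; -2186; 0; 0; 0]; [:: 68524; 0; 0; 0; 0];
      [:: 32295; 5485; 1; 0; 0]; [:: 9060; -9805; 0; 0; 0];
      [:: 8346; 31698; 0; 0; 0]; [:: 29774; -10112; 0; 0; 0];
      [:: 17752; -9417; 0; 0; 0]; [:: 32295; 5485; 1; 0; 0];
      [:: 43038; -46868; 0; 0; 0]; [:: -37724; -9283; 0; 0; 0];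
      [:: 25097; 2439; 0; 0; 0]; [:: 51774; -26943; 0; 1; 0];
      [:: 32295; 5485; 1; 0; 0]; [:: 35847; -10096; 0; 0; 0];
      [:: 29797; -4551; 0; 0; 0]; [:: -32110; 26664; 0; -1; -1];
      [:: 30569; 5494; 0; 0; 0]; [:: 32846; 22205; 0; 0; 0];
      [:: 5343; -20793; 0; 0; 0]; [:: -41716; -30068; 0; 0; 0];
      [:: -32110; 26664; 0; -1; -1]; [:: 29502; -4878; 0; 0; 0];
      [:: 6942; -7457; 0; 0; 0]; [:: -5085; -6186; 0; 0; 0];
      [:: 27563; 51764; 0; 0; 0]; [:: -34965; -4803; 0; 0; 0];
      [:: -12631; -5764; -1; 0; -1]; [:: 8692; -860; 0; 0; 0]])%Z);
  ([:: 0; 3; 4; 1; 2]%N,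
   ([:: 5760; 5760; 54209323472; 37578903512],
    [::
      [:: 23921; -4220; 0; 0]; [:: -26425; 33470; 0; 0]; [:: -753; -9320; 0; 0];
      [:: 2194; -24991; 1; 0]; [:: 11544; 33064; 0; 0]; [:: -13331; 9264; 0; 1];
      [:: -26425; 33470; 0; 0]; [:: 39494; -1507; 0; 0]; [:: 4333; -14210; 0; 0];
      [:: 11137; 15727; 0; -1]; [:: 15160; 9241; 0; 0]; [:: -778; -8649; 0; 0];
      [:: -753; -9320; 0; 0]; [:: 4333; -14210; 0; 0]; [:: 69121; 0; 0; 0];
      [:: 16055; 16473; 0; 0]; [:: 11137; 15727; 0; -1]; [:: -18641; 475; 0; 0];
      [:: 2194; -24991; 0; 0]; [:: 11137; 15727; -1; -1]; [:: 16055; 16473; 0; 0];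
      [:: -2685; -2632; 0; 0]; [:: -15718; -10921; 0; 0]; [:: 11137; 15727; 0; -1];
      [:: 11544; 33064; 0; 0]; [:: 15160; 9241; 0; 0]; [:: 11137; 15727; -1; -1];
      [:: -15718; -10921; 0; 0]; [:: -43846; -33123; 0; 0]; [:: 8930; -4751; 0; 0];
      [:: -13331; 9264; 0; 1]; [:: -778; -8649; 0; 0]; [:: -18641; 475; 0; 0];
      [:: 11137; 15727; -1; -1]; [:: 8930; -4751; 0; 0]; [:: 1487; -2217; 0; 0]])%Z);
  ([:: 0; 3; 4; 2; 1]%N,
   ([:: 5760; 5760; 37244953460; 18430882434248; 9056595671572; 42115737656],
    [::
      [:: -34813; -31682; 0; 0; 0; 0]; [:: 28787; 20388; 1; 0; 0; 1];
      [:: -11282; 13348; 0; 0; 0; 0]; [:: -51140; -33008; 0; 0; 0; 0];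
      [:: 10463; 6622; 0; 0; 0; 0]; [:: 16635; 5244; 0; 0; 0; 0];
      [:: 28787; 20388; 1; 0; 0; 1]; [:: -22345; -24533; 0; 0; 0; 0];
      [:: -3960; -15933; 0; 0; 0; 0]; [:: -29164; -16306; 0; 0; 0; 0];
      [:: -3217; -1463; 0; 1; 0; 0]; [:: 5893; 757; 0; 0; 0; 0];
      [:: 2614; 10028; 0; 0; 0; 0]; [:: -47714; -27173; 0; 0; 1; -1];
      [:: -3021; 338; 0; 0; 0; 0]; [:: -3217; -1463; 0; 1; 0; 0];
      [:: -12870; -8656; 0; 0; 0; 0]; [:: 18927; 6785; -1; 0; -1; 0];
      [:: -422; 5966; 0; 0; 0; 0]; [:: -29757; -11980; 0; 0; 0; 0];
      [:: -26449; 44253; 0; 0; 0; 0]; [:: 24417; -8353; 0; 0; 0; 0];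
      [:: 18927; 6785; -1; 0; -1; 0]; [:: -10549; -5855; 0; 0; 0; 0];
      [:: 75404; 0; 0; 0; 0; 0]; [:: 57000; -21335; 0; 0; 0; 0];
      [:: -43048; -16064; 0; 0; 0; 0]; [:: -23777; 37090; 0; 0; 0; 0];
      [:: -34825; -4719; 0; 0; 0; 0]; [:: -7104; -3718; 0; 0; 0; 0];
      [:: -11690; 885; 0; 0; 0; 0]; [:: -30641; -3077; 0; 0; 0; 0];
      [:: 31489; -25023; 0; 0; 0; 0]; [:: -14242; -1977; 0; 0; 0; 0];
      [:: -25570; -18925; -1; -1; 0; -1]; [:: -2974; -7328; 0; 0; 0; 0]])%Z);
  ([:: 0; 4; 2; 3; 1]%N,
   ([:: 5760; 41205585688],
    [::
      [:: -971; 0]; [:: -3504; 0]; [:: 2742; 0]; [:: -26056; 0]; [:: -47300; 1];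
      [:: 11177; 0]; [:: -28800; 0]; [:: -756; 0]; [:: -436; 0]; [:: 39882; 0];
      [:: 2976; 0]; [:: 24857; 0]; [:: -16405; 0]; [:: -14980; 0]; [:: -19455; -1];
      [:: 2771; 0]; [:: 28776; 0]; [:: 20379; 0]; [:: 19698; 0]; [:: -1602; 0];
      [:: -10648; 0]; [:: -19455; -1]; [:: 31737; 0]; [:: 17362; 0]; [:: 66755; 0];
      [:: 11977; 0]; [:: -50194; 0]; [:: -23268; 0]; [:: -19455; -1];
      [:: -11817; 0]; [:: -22537; 0]; [:: -50961; 0]; [:: 2670; 0]; [:: -16681; 0];
      [:: 7064; 0]; [:: -3722; 0]])%Z);
  ([:: 0; 4; 3; 2; 1]%N,
   ([:: 5760; 374453029920],
    [::
      [:: -9994; -1]; [:: -9994; -1]; [:: -9994; -1]; [:: 8093; 0]; [:: 2690; 0];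
      [:: 19988; 2]; [:: -9994; -1]; [:: -9994; -1]; [:: -9994; -1]; [:: 27682; 0];
      [:: -7645; 0]; [:: 19988; 2]; [:: -9994; -1]; [:: -9994; -1]; [:: -5700; 0];
      [:: -20058; 0]; [:: 19988; 2]; [:: 4519; 0]; [:: 8093; 0]; [:: 27682; 0];
      [:: -20058; 0]; [:: 19988; 2]; [:: -12455; 0]; [:: 9187; 0]; [:: 2690; 0];
      [:: -7645; 0]; [:: 19988; 2]; [:: -12455; 0]; [:: -10468; 0]; [:: -9994; -1];
      [:: 19988; 2]; [:: 19988; 2]; [:: 4519; 0]; [:: 9187; 0]; [:: -9994; -1];
      [:: -9994; -1]])%Z);
  ([:: 1; 0; 2; 4; 3]%N,
   ([:: 5760; 410207903638; 4473942128180],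
    [::
      [:: 9703; 0; 0]; [:: -33329; 0; 0]; [:: -22674; 1; 0]; [:: -22674; 1; 0];
      [:: 18344; 0; 0]; [:: -17350; 0; 0]; [:: 10098; 0; 0]; [:: -22674; 1; 0];
      [:: -32966; 0; 0]; [:: 45348; 0; 1]; [:: 39797; 0; 0]; [:: -20464; 0; 0];
      [:: -22674; 1; 0]; [:: 40728; 0; 0]; [:: 22241; 0; 0]; [:: 45348; 0; 1];
      [:: 45348; 0; 1]; [:: -22674; -1; -1]; [:: -22674; 1; 0]; [:: 45348; 0; 1];
      [:: 45348; 0; 1]; [:: 22241; 0; 0]; [:: 40728; 0; 0]; [:: -22674; -1; -1];
      [:: -20464; 0; 0]; [:: 39797; 0; 0]; [:: 45348; 0; 1]; [:: -32966; 0; 0];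
      [:: -22674; -1; -1]; [:: 10098; 0; 0]; [:: -17350; 0; 0]; [:: 18344; 0; 0];
      [:: -22674; -1; -1]; [:: -22674; -1; -1]; [:: -33329; 0; 0]; [:: 9703; 0; 0]])%Z);
  ([:: 1; 0; 3; 4; 2]%N,
   ([:: 5760; 5760; 5760; 5760; 77615823496; 49080093272; 58153751000; 26732773416;
   52465752136; 45863014544],
    [::
      [:: -1957; -31922; -19533; 5330; 0; 0; 0; 0; 0; 0];
      [:: 75591; -64695; -27568; 8423; 0; 0; 0; 0; 0; 0];
      [:: -7582; -16870; -52407; 326; 0; 0; 1; 1; 0; 0];
      [:: -10301; -13499; -31107; 3919; 0; 0; 0; 0; 0; 0];
      [:: -27890; -64557; -34615; 17484; 0; 0; 0; 0; 0; 0];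
      [:: -11599; -9892; 7459; 3686; 0; 0; 0; 0; 0; 0];
      [:: -83652; -2080; 39182; -1383; 0; 0; 0; 0; 0; 0];
      [:: -7582; -16870; -52407; 326; 0; 0; 1; 1; 0; 0];
      [:: 139621; 0; 0; 0; 0; 0; 0; 0; 0; 0];
      [:: 101145; -27575; 537; -8596; 0; 0; 0; 0; 0; 0];
      [:: -8858; 11984; -36254; 37920; 0; 0; 0; 0; 0; 0];
      [:: 33470; -28539; -37454; 1266; 0; 0; 0; 0; 0; 0];
      [:: -7582; -16870; -52407; 326; 0; 0; 1; 1; 0; 0];
      [:: -19566; -34455; 71724; 0; 0; 0; 0; 0; 0; 0];
      [:: 59464; -36215; -6175; 13051; 0; 0; 0; 0; 0; 0];
      [:: 39296; -27950; 5870; -3078; 0; 0; 0; 0; 0; 0];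
      [:: -34812; -12899; -10539; 39895; 0; 1; 0; 0; 0; 1];
      [:: -50443; -11208; 19408; -23509; 0; 0; 0; 0; 0; 0];
      [:: 15274; 32897; -8347; 7816; 0; 0; 0; 0; 0; 0];
      [:: -57949; 112419; 0; 0; 0; 0; 0; 0; 0; 0];
      [:: -36899; 44701; 8422; 15217; 1; 0; 0; -1; 1; 0];
      [:: -34812; -12899; -10539; 39895; 0; 1; 0; 0; 0; 1];
      [:: -51855; -82833; -65055; 4894; 0; 0; 0; 0; 0; 0];
      [:: 44481; -27831; 43985; -15543; -1; 0; -1; 0; -1; 0];
      [:: 30663; 65860; 20789; -2843; 0; 0; 0; 0; 0; 0];
      [:: -60502; 95924; 41222; -1409; 0; 0; 0; 0; 0; 0];
      [:: 7226; 73994; 9961; -381; 0; 0; 0; 0; 0; 0];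
      [:: -28527; -45378; 13648; -16309; 0; 0; 0; 0; 0; 0];
      [:: 44481; -27831; 43985; -15543; -1; 0; -1; 0; -1; 0];
      [:: -28664; -63740; -44248; 17143; 0; 0; 0; 0; 0; 0];
      [:: -18863; -36564; -31072; -1126; 0; 0; 0; 0; 0; 0];
      [:: -39915; -12233; 7376; 6478; 0; 0; 0; 0; 0; 0];
      [:: -31733; -57159; 18009; -9082; 0; 0; 0; 0; 1; 1];
      [:: 2620; 48262; 721; -6752; 0; 0; 0; 0; 0; 0];
      [:: 42394; 29769; 62946; -40221; 0; -1; -1; -1; 0; -1];
      [:: 2916; -331; -35846; 28938; 0; 0; 0; 0; 0; 0]])%Z);
  ([:: 1; 2; 4; 0; 3]%N,
   ([:: 5760; 5760; 5760; 43011802200; 58409451136; 14417333584192; 61146838712],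
    [::
      [:: 12828; 17450; 132; 0; 0; 0; 0]; [:: 10021; 76958; 2728; 0; 0; 0; 0];
      [:: 92187; 0; 0; 0; 0; 0; 0]; [:: 7562; 11606; 8139; 0; 0; 0; 0];
      [:: -8179; 19110; 24160; 0; 0; 0; 0]; [:: 27521; 16746; -8283; 0; 0; 0; 1];
      [:: -5374; -48479; 52299; 1; 0; 0; 0]; [:: 66463; -34203; 35943; 0; 0; 0; 0];
      [:: 14345; 90000; 0; 0; 0; 0; 0]; [:: -20609; 17463; -38137; 0; 0; 1; 0];
      [:: -18448; 33996; -51990; 0; 0; 0; 0]; [:: -5373; 42328; -1990; 0; 0; 0; 0];
      [:: 6143; -5239; -19017; 0; 0; 0; 0]; [:: 38636; 37424; -7656; 0; 0; 0; 0];
      [:: -20609; 17463; -38137; 0; 0; 1; 0]; [:: -9988; 23403; 16547; 0; 0; 0; 0];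
      [:: -12999; -15977; 32953; 0; -1; 0; -1];
      [:: -25474; 3143; 25190; 0; 0; 0; 0]; [:: -14522; -769; -24670; 0; 1; 0; 0];
      [:: 16805; 55679; 4847; 0; 0; 0; 0]; [:: -12840; 7924; -8418; 0; 0; 0; 0];
      [:: 4774; 10676; -11143; 0; 0; 0; 0]; [:: -15233; -257; 20927; 0; 0; 0; 0];
      [:: -12999; -15977; 32953; 0; -1; 0; -1];
      [:: -6432; -5025; 32264; 0; 0; 0; 0]; [:: -14522; -769; -24670; 0; 1; 0; 0];
      [:: -45917; -3490; 3203; 0; 0; 0; 0]; [:: 20953; 16107; 338; 0; 0; 0; 0];
      [:: 25983; 31016; -14162; -1; 0; -1; 0];
      [:: -11731; -8304; 1294; 0; 0; 0; 0]; [:: 27521; 16746; -8283; 0; 0; 0; 1];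
      [:: -16659; -57957; -16099; 0; 0; 0; 0];
      [:: -17742; -37068; -32307; 0; 0; 0; 0];
      [:: 25983; 31016; -14162; -1; 0; -1; 0]; [:: 15742; 16864; 4683; 0; 0; 0; 0];
      [:: -6278; 240; 7411; 0; 0; 0; 0]])%Z);
  ([:: 1; 3; 0; 4; 2]%N,
   ([:: 5760; 5760; 5760; 43599755750; 44889304525],
    [::
      [:: -62485; 24638; -14660; 0; 0]; [:: -65609; 33369; -25354; 0; 0];
      [:: 24150; -32030; -547; 0; 1]; [:: 11001; 10025; -5165; 0; 0];
      [:: -1949; -12166; -9421; 0; 0]; [:: 8358; -3736; -4614; 0; 0];
      [:: 115555; 0; 0; 0; 0]; [:: 24150; -32030; -547; 0; 1];
      [:: -83652; 68755; 0; 0; 0]; [:: -48450; 35074; -19573; 0; 0];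
      [:: -47920; -27643; 2541; 0; 0]; [:: -55713; 211; -4832; 0; 0];
      [:: 93950; -6247; 35066; 0; 0]; [:: -3179; -38784; -27011; 0; 0];
      [:: -73505; -40864; -34856; 0; 0]; [:: -57347; -9728; 4703; 0; 0];
      [:: -45240; 34701; -19676; 0; 0]; [:: -39267; 18966; -2101; 0; 0];
      [:: -40257; -46455; -22894; 0; 0]; [:: 56876; -13259; 23755; 0; 0];
      [:: 22151; -6902; -30466; 1; 0]; [:: -3823; 33276; 1277; 0; 0];
      [:: 32081; 9489; -25103; 0; 0]; [:: -46301; 38932; 31013; -1; -1];
      [:: -7248; 7903; 12952; 0; 0]; [:: 39422; -30968; 24317; 0; 0];
      [:: 28351; -19199; 20354; 0; 0]; [:: 12297; 5188; -6152; 0; 0];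
      [:: -46301; 38932; 31013; -1; -1]; [:: -18694; 13988; -33363; 0; 0];
      [:: 5970; -3590; -5148; 0; 0]; [:: 62500; -9788; 6235; 0; 0];
      [:: 6798; 4935; 2124; 0; 0]; [:: 6456; -49347; 13024; 0; 0];
      [:: -9153; 12609; 3133; 0; 0]; [:: -8983; 39367; -6607; 0; 0]])%Z);
  ([:: 1; 3; 4; 0; 2]%N,
   ([:: 5760; 5760; 5760; 46845124536; 50675874200; 51919961816],
    [::
      [:: 21248; 10792; 6997; 0; 0; 0]; [:: 42459; 62971; 0; 0; 0; 0];
      [:: 14570; -25630; -7435; 0; 0; 0]; [:: 54365; 1103; 16743; 0; 0; 0];
      [:: -29112; 12698; 20042; 0; 0; 0]; [:: 5831; 16954; -2677; 0; 0; 1];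
      [:: -50300; -15199; 8078; 0; 0; 0]; [:: 17478; 29167; -6137; 0; 0; 0];
      [:: 64560; 53645; -6813; 0; 0; 0]; [:: 23459; 25340; 21610; -1; -1; 0];
      [:: -8053; 6624; 2766; 0; 0; 0]; [:: -4246; -41357; 7390; 0; 0; 0];
      [:: -15303; -36520; 9334; 0; 0; 0]; [:: 5409; 15743; 2232; 0; 0; 0];
      [:: -13607; 15953; -5559; 0; 0; 0]; [:: 25498; -16334; -933; 0; 0; 0];
      [:: 23459; 25340; 21610; -1; -1; 0]; [:: -14982; 9046; -49866; 0; 0; 0];
      [:: -29290; -42294; -18933; 1; 1; -1]; [:: 3078; 16164; -48631; 0; 1; 0];
      [:: -18861; 37539; -25454; 0; 0; 0]; [:: -22045; 24630; 354; 0; 0; 0];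
      [:: 14013; -26618; -40635; 0; 0; 0]; [:: 23459; 25340; 21610; -1; -1; 0];
      [:: -40675; -24366; -18641; 0; 0; 0]; [:: -29290; -42294; -18933; 1; 1; -1];
      [:: -44959; 28898; -15064; 0; 0; 0]; [:: 12077; -1973; 47074; 0; 0; 0];
      [:: 85590; 0; 0; 0; 0; 0]; [:: 3783; -24807; 26093; 0; 0; 0];
      [:: 5831; 16954; -2677; 0; 0; 1]; [:: -26537; -41504; 27021; 1; 0; 0];
      [:: -6016; -26323; 50033; 0; 0; 0]; [:: -43657; 30398; -45794; 0; 0; 0];
      [:: 12610; 39026; -20370; 0; 0; 0]; [:: 3878; -15883; -4488; 0; 0; 0]])%Z)].

(** * Flags and their weighted squares *)

(** A diagonal quadratic form in polarized shape. Stopping at the shortest list is what makes absent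
    rows act as zero vectors. *)
Fixpoint wdot (c a b : seq Z) : Z :=
  match c, a, b with
  | c0 :: c', a0 :: a', b0 :: b' => Z.add (Z.mul c0 (Z.mul a0 b0)) (wdot c' a' b')
  | _, _, _ => 0%Z
  end.

Fixpoint eq_natseq (s t : seq nat) : bool :=
  match s, t with
  | [::], [::] => true
  | i :: s', j :: t' => Nat.eqb i j && eq_natseq s' t'
  | _, _ => false
  end.

Fixpoint assoc (A : Type) (d : A) (l : seq (seq nat * A)) (s : seq nat) : A :=
  if l is (k, a) :: l' then if eq_natseq k s then a else assoc d l' s else d.

Section Flags.
Variables (T : Type) (r1 r2 : rel T).

Definition rank (r : rel T) (t : seq T) (x : T) : nat := count (r^~ x) t.

(* [r1] and [r2] are the orders of the points by position and by value. *)
Definition cell_coef (t : seq T) : seq Z :=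
  if sorted r1 t then (assoc ([::], [::]) cell_flags (map (rank r2 t) t)).1
  else [::].

Definition cell_flag (t u : seq T) : seq Z :=
  if u is [:: x] then
    nth [::] (assoc ([::], [::]) cell_flags (map (rank r2 t) t)).2
      (6 * rank r1 t x + rank r2 t x)
  else [::].

Definition cell_sq (x : seq T) : Z :=
  wdot (cell_coef (take 5 x)) (cell_flag (take 5 x) (take 1 (drop 5 x)))
    (cell_flag (take 5 x) (take 1 (drop 6 x))).

Definition pair_coef (t : seq T) : seq Z :=
  if sorted r1 t && sorted r2 t then pair_flags.1 else [::].

(** The index encodes the cell of [x] and the cell of [y] in the 3 by 3 grid cut out by [t], then
    one bit for their order by value. Requiring [r1 x y] counts each unordered extension once. *)
Definition pair_flag (t u : seq T) : seq Z :=
  if u is [:: x; y] then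
    if r1 x y then
      nth [::] pair_flags.2
        (((3 * rank r1 t x + rank r2 t x) * 9
          + (3 * rank r1 t y + rank r2 t y)) * 2 + r2 x y)
    else [::]
  else [::].

(** Two labels and two disjoint pairs use six points; a seventh entry is carried along so that both
    kinds of squares live on seven points. *)
Definition pair_sq (x : seq T) : Z :=
  wdot (pair_coef (take 2 x)) (pair_flag (take 2 x) (take 2 (drop 2 x)))
    (pair_flag (take 2 x) (take 2 (drop 4 x))).

(** The factors bring the two kinds of averages to the common denominator 15120 = 45 * 8 * 42 = 3 *
    8 * 630. *)
Definition square (x : seq T) : Z := (45 * cell_sq x + 3 * pair_sq x)%Z.

Definition monotone4 (x : seq T) : bool :=
  sorted r1 (take 4 x) &&
  (sorted r2 (take 4 x) || sorted (fun a b => r2 b a) (take 4 x)).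

End Flags.

(** * Efficient evaluation on patterns of seven points *)

(* [memo] tabulates functions on permutations whose values are needed several times. *)
Inductive trie (A : Type) := Leaf of A | Node of seq (trie A).
Arguments Leaf {A}. Arguments Node {A}.

Fixpoint get (A : Type) (d : A) (t : trie A) (s : seq nat) : A :=
  match s, t with
  | [::], Leaf a => a
  | i :: s', Node ch => get d (nth (Leaf d) ch i) s'
  | _, _ => d
  end.

Fixpoint memo (A : Type) (d : A) (n k : nat) (used : seq nat) (f : seq nat -> A) : trie A :=
  if k is k'.+1 then
    Node [seq if i \in used then Leaf d
              else memo d n k' (i :: used) (fun s => f (i :: s)) | i <- iota 0 n]
  else Leaf (f [::]).

Fixpoint sumZ (s : seq Z) : Z := if s is x :: s' then Z.add x (sumZ s') else 0%Z.

(* Ranks among the five points left when positions [u] and [v] are removed. *)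
Definition subranks (q : seq nat) (s : seq nat) (u v : nat) :=
  let qu := nth 0 q u in let qv := nth 0 q v in
  [seq (let x := nth 0 q i in x - (qu < x) - (qv < x)) | i <- s].

(** The two extensions are the positions [u] and [v], so a rank among the five labels is the rank
    among all seven, corrected by the other extension. No row is looked up for a pattern without
    coefficients. *)
Definition cell_sq_fast (tab : trie (seq Z * seq (seq Z))) (q s : seq nat) : Z :=
  let u := nth 0 s 5 in let v := nth 0 s 6 in
  let qu := nth 0 q u in let qv := nth 0 q v in
  let: (co, rows) := get ([::], [::]) tab (subranks q (take 5 s) u v) in
  if co is [::] then 0%Z else
  wdot co (nth [::] rows (6 * (u - (v < u)) + (qu - (qv < qu))))
          (nth [::] rows (6 * (v - (u < v)) + (qv - (qu < qv)))).

Definition byval (q : seq nat) : rel nat := fun i j => nth 0 q i < nth 0 q j.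

Definition subseqs (k n : nat) : seq (seq nat) :=
  [seq s <- foldr (fun i ss => [seq i :: s | s <- ss] ++ ss) [:: [::]] (iota 0 n)
     | size s == k].

Definition others (n : nat) (s : seq nat) := [seq i <- iota 0 n | i \notin s].

(* The extensions form an unordered pair here, whence the factors 2 in [square_val] and
   [pair_val]. *)
Definition cell_splits : seq (seq nat) := [seq others 7 s ++ s | s <- subseqs 2 7].
Definition pair_splits : seq (seq nat) :=
  [seq t ++ s | t <- [seq others 6 s | s <- subseqs 4 6],
       s <- [seq [seq nth 0 (others 6 t) i | i <- p]
             | p <- [:: [:: 0;1;2;3]; [:: 0;2;1;3]; [:: 0;3;1;2]]]].

Definition inversep (q : seq nat) := [seq index v q | v <- iota 0 (size q)].
Definition complement (q : seq nat) := [seq (size q).-1 - v | v <- q].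
(** The eight symmetries of the square acting on [q], with repetitions kept, in the same order as
    the entries of [views]. *)
Definition images (q : seq nat) :=
  flatten [seq flatten [seq [:: p'; complement p'] | p' <- [:: p; rev p]]
    | p <- [:: q; inversep q]].

Definition remove_std (q : seq nat) (i : nat) :=
  let x := nth 0 q i in [seq v - (x < v) | v <- take i q ++ drop i.+1 q].

Definition pair_val (q : seq nat) : Z :=
  (2 * sumZ [seq pair_sq ltn (byval q) s | s <- pair_splits])%Z.

Definition cell_table := memo ([::], [::]) 5 5 [::] (assoc ([::], [::]) cell_flags).
Definition pair_table := memo 0%Z 6 6 [::] pair_val.

Definition square_val t5 t6 (q : seq nat) : Z :=
  (45 * (2 * sumZ [seq cell_sq_fast t5 q s | s <- cell_splits])
   + 3 * sumZ [seq get 0%Z t6 (remove_std q i) | i <- iota 0 7])%Z.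

Definition square_table := memo 0%Z 7 7 [::] (square_val cell_table pair_table).

Definition mono_val (q : seq nat) : Z :=
  Z.of_nat (count (monotone4 ltn (byval q)) (subseqs 4 7)).

(* [F / 35 >= 1 / 27 + S] multiplied by [15120 * scale]: a square of a cell flag is
   averaged over 8 symmetries and 42 choices of points, one of a pair flag over
   8 symmetries and [7 * 15 * 6] choices. *)
Definition certified t7 (q : seq nat) : bool :=
  Z.leb (560 * scale + sumZ [seq get 0%Z t7 p | p <- images q]) (432 * scale * mono_val q).

Definition all_certified t7 : bool := all (certified t7) (permutations (iota 0 7)).

Local Open Scope ring_scope.

(** * Sums over tuples and over orderings of a set of points *)

Lemma sum_tuple_cat (R : nmodType) (T : finType) m k (F : seq T -> R) :
  \sum_(x : (m + k).-tuple T) F x =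
  \sum_(a : m.-tuple T) \sum_(b : k.-tuple T) F (a ++ b).
Proof.
rewrite pair_big /=.
pose f (p : m.-tuple T * k.-tuple T) : (m + k).-tuple T := [tuple of p.1 ++ p.2].
have mP (x : (m + k).-tuple T) : size (take m x) == m.
  by rewrite size_takel // size_tuple leq_addr.
have kP (x : (m + k).-tuple T) : size (drop m x) == k.
  by rewrite size_drop size_tuple addKn.
rewrite (reindex f) //=.
exists (fun x => (Tuple (mP x), Tuple (kP x))).
  move=> [a b] _; congr pair; apply: val_inj => /=.
    by rewrite take_size_cat ?size_tuple.
  by rewrite drop_size_cat ?size_tuple.
by move=> x _; apply: val_inj; rewrite /= cat_take_drop.
Qed.

Lemma perm_permutations_nth (T : eqType) x0 (y : seq T) : uniq y ->
  perm_eq (permutations y)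
    [seq map (nth x0 y) s | s <- permutations (iota 0 (size y))].
Proof.
move=> yU; apply: uniq_perm; first exact: permutations_uniq.
  rewrite map_inj_in_uniq ?permutations_uniq // => s t.
  rewrite !mem_permutations => sP tP.
  apply: (@inj_in_map _ _ _ (fun i => i \in iota 0 (size y))); last 2 first.
  - by apply/allP => i; rewrite (perm_mem sP).
  - by apply/allP => i; rewrite (perm_mem tP).
  move=> i j; rewrite !mem_iota => ilt jlt /eqP.
  by rewrite nth_uniq // => /eqP.
move=> z; rewrite mem_permutations; apply/(perm_iotaP x0)/mapP.
  by move=> [Is IsP ->]; exists Is => //; rewrite mem_permutations.
by move=> [Is]; rewrite mem_permutations => IsP ->; exists Is.
Qed.

(** Injective tuples are grouped by their underlying set, represented by its increasing enumeration
    [y]; the members of a group are the orderings of [y]. *)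
Lemma sum_uniq_ge0 (R : numDomainType) n k (F : seq 'I_n -> R) :
  (forall y : seq 'I_n, uniq y -> size y = k -> sorted (fun i j : 'I_n => i < j)%N y ->
     0 <= \sum_(z <- permutations y) F z) ->
  0 <= \sum_(x : k.-tuple 'I_n | uniq x) F x.
Proof.
move=> Fge0.
pose le := fun i j : 'I_n => (i <= j)%N.
rewrite (partition_big (fun x : k.-tuple 'I_n => [tuple of sort le x])
  (fun y : k.-tuple 'I_n => uniq y)) /=; last by move=> x; rewrite sort_uniq.
apply: sumr_ge0 => y yU.
(* A tuple [y] that is not sorted is never the result of a sort, so its group is empty. *)
have [/eqP yS|yS] := boolP (sort le y == y); last first.
  rewrite big_pred0 // => x; apply/negP => /andP[_ /eqP xy].
  move/eqP: yS; rewrite -xy /=; apply.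
  apply: (sorted_sort _ (sort_sorted _ _)) => [i j l|i j]; [exact: leq_trans|exact: leq_total].
have leT : transitive le by move=> i j l; exact: leq_trans.
have letot : total le by move=> i j; exact: leq_total.
suff -> : \sum_(x : k.-tuple 'I_n | uniq x && ([tuple of sort le x] == y)) F x =
          \sum_(z <- permutations y) F z.
  apply: Fge0; rewrite ?size_tuple // -yS.
  have := sort_sorted letot y; have: uniq (sort le y) by rewrite sort_uniq.
  rewrite yS => {}yU yle.
  rewrite -[sorted _ _]/(sorted (relpre val ltn) y) -sorted_map ltn_sorted_uniq_leq.
  rewrite map_inj_uniq ?yU /=; last exact: val_inj.
  by rewrite sorted_map.
rewrite -big_filter -(big_map (@tval _ _) xpredT F).
apply/perm_big/uniq_perm; rewrite ?permutations_uniq //.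
  by rewrite map_inj_uniq ?filter_uniq ?index_enum_uniq //; exact: val_inj.
move=> z; rewrite mem_permutations; apply/mapP/idP => [[x]|zy].
  rewrite mem_filter => /andP[/andP[xU /eqP <-] _] -> /=.
  by rewrite perm_sym perm_sort.
have zs : size z == k by rewrite (perm_size zy) size_tuple.
exists (Tuple zs) => //; rewrite mem_filter mem_index_enum andbT /= (perm_uniq zy) yU /=.
apply/eqP/val_inj => /=; rewrite -[RHS]yS; apply/perm_sortP => //.
by move=> i j; rewrite -eqn_leq => /eqP/val_inj.
Qed.

(** * The squares sum to a nonnegative number *)

Lemma wdotE c a b : wdot c a b = \sum_(j < size c) c`_j * a`_j * b`_j.
Proof.
elim: c a b => [|c0 c IHc] [|a0 a] [|b0 b] /=; rewrite ?big_ord0 //;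
  try by rewrite big1 // => j _; rewrite !nth_nil ?mulr0 ?mul0r.
rewrite big_ord_recl /= -IHc; exact: (congr1 (fun z : Z => z + _) (mulrA _ _ _)).
Qed.

Lemma sum_tuple_cat4 (R : nmodType) (T : finType) k l m n (F : seq T -> R) :
  \sum_(x : (k + (l + (m + n))).-tuple T) F x =
  \sum_(a : k.-tuple T) \sum_(b : l.-tuple T) \sum_(c : m.-tuple T)
    \sum_(d : n.-tuple T) F (a ++ b ++ c ++ d).
Proof.
rewrite sum_tuple_cat; apply: eq_bigr => a _.
rewrite (sum_tuple_cat _ _ (fun x => F (a ++ x))); apply: eq_bigr => b _.
by rewrite (sum_tuple_cat _ _ (fun x => F (a ++ b ++ x))).
Qed.

(** With the labels [t] and the idle entries [w] fixed, the two extensions range independently over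
    all tuples, coincidences included, so their double sum factors into a combination of squares
    with coefficients [c t]. *)
Lemma sum_wdot_ge0 (T : finType) k l m (c : seq T -> seq Z) (f : seq T -> seq T -> seq Z) :
  (forall t j, 0 <= (c t)`_j) ->
  0 <= \sum_(x : (k + (l + (l + m))).-tuple T)
     wdot (c (take k x)) (f (take k x) (take l (drop k x)))
       (f (take k x) (take l (drop (k + l) x))).
Proof.
move=> c_ge0.
rewrite (sum_tuple_cat4 k l l m (fun x => wdot (c (take k x))
  (f (take k x) (take l (drop k x))) (f (take k x) (take l (drop (k + l) x))))).
apply: sumr_ge0 => t _.
have -> : \sum_(u : l.-tuple T) \sum_(v : l.-tuple T) \sum_(w : m.-tuple T)
    wdot (c (take k (t ++ u ++ v ++ w)))
      (f (take k (t ++ u ++ v ++ w)) (take l (drop k (t ++ u ++ v ++ w))))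
      (f (take k (t ++ u ++ v ++ w)) (take l (drop (k + l) (t ++ u ++ v ++ w)))) =
  \sum_(w : m.-tuple T) \sum_(j < size (c t)) (c t)`_j * (\sum_(u : l.-tuple T) (f t u)`_j) ^+ 2.
  under eq_bigr => u _ do rewrite exchange_big /=.
  rewrite [LHS]exchange_big /=; apply: eq_bigr => w _.
  under [RHS]eq_bigr => j _ do rewrite expr2 big_distrlr /= mulr_sumr.
  rewrite [RHS]exchange_big /=; apply: eq_bigr => u _.
  under [RHS]eq_bigr => j _ do rewrite mulr_sumr.
  rewrite [RHS]exchange_big /=; apply: eq_bigr => v _.
  rewrite take_size_cat ?size_tuple // drop_size_cat ?size_tuple //.
  rewrite take_size_cat ?size_tuple // addnC -drop_drop.
  rewrite !drop_size_cat ?size_tuple // take_size_cat ?size_tuple // wdotE.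
  by apply: eq_bigr => j _; rewrite mulrA.
apply: sumr_ge0 => w _; apply: sumr_ge0 => j _.
by rewrite mulr_ge0 ?sqr_ge0.
Qed.

Definition certificate_ge0 :=
  all (fun z => Z.leb 0 z) pair_flags.1 && all (fun p => all (fun z => Z.leb 0 z) p.2.1) cell_flags.

Lemma certificate_ge0P : certificate_ge0.
Proof. by vm_compute. Qed.

Lemma all_nth_ge0 (s : seq Z) j : all (fun z => Z.leb 0 z) s -> 0 <= s`_j.
Proof.
move=> /all_nthP s0; have [lt_js|le_sj] := ltnP j (size s); first exact: s0.
by rewrite nth_default.
Qed.

Lemma assoc_cell_ge0 s : all (fun z => Z.leb 0 z) (assoc ([::], [::]) cell_flags s).1.
Proof.
have /andP[_] := certificate_ge0P.
elim: cell_flags => //= -[k [c f]] l IHl /= /andP[c0 l0].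
by case: ifP => // _; exact: IHl.
Qed.

Section Squares.
Variables (T : finType) (r1 r2 : rel T).

Lemma sum_cell_sq_ge0 : 0 <= \sum_(x : 7.-tuple T) cell_sq r1 r2 x.
Proof.
apply: (@sum_wdot_ge0 T 5 1 0 (cell_coef r1 r2) (cell_flag r1 r2)) => t j.
rewrite /cell_coef; case: ifP => _; last by rewrite nth_nil.
exact/all_nth_ge0/assoc_cell_ge0.
Qed.

Lemma sum_pair_sq_ge0 : 0 <= \sum_(x : 7.-tuple T) pair_sq r1 r2 x.
Proof.
apply: (@sum_wdot_ge0 T 2 2 1 (pair_coef r1 r2) (pair_flag r1 r2)) => t j.
rewrite /pair_coef; case: ifP => _; last by rewrite nth_nil.
by have /andP[+ _] := certificate_ge0P; exact: all_nth_ge0.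
Qed.

End Squares.

(** * Dependence on the two orders only *)

Section Naturality.
Variables (S T : eqType) (g : S -> T) (D : {pred S}) (r1 r2 : rel T) (s1 s2 : rel S).
Hypotheses (r1g : {in D &, forall a b, r1 (g a) (g b) = s1 a b})
  (r2g : {in D &, forall a b, r2 (g a) (g b) = s2 a b}).

(** The set [D] confines the comparison to indices in range; beyond them [nth] returns its default
    value and the orders need not correspond. *)
Lemma sorted_natural (r : rel T) (s : rel S) t :
  {in D &, forall a b, r (g a) (g b) = s a b} -> {subset t <= D} ->
  sorted r (map g t) = sorted s t.
Proof.
move=> rg tD; rewrite sorted_map; apply: (eq_in_sorted (P := D)).
  by move=> a b aD bD /=; exact: rg.
exact/allP.
Qed.

Lemma rank_natural (r : rel T) (s : rel S) t x :
  {in D &, forall a b, r (g a) (g b) = s a b} -> {subset t <= D} -> x \in D ->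
  rank r (map g t) (g x) = rank s t x.
Proof.
move=> rg tD xD; rewrite /rank count_map; apply: eq_in_count => a /tD aD /=.
exact: rg.
Qed.

Lemma ranks_natural t : {subset t <= D} ->
  map (rank r2 (map g t)) (map g t) = map (rank s2 t) t.
Proof.
move=> tD; rewrite -map_comp; apply/eq_in_map => x xt /=.
by apply: rank_natural => //; exact: tD.
Qed.

Lemma cell_coef_natural t : {subset t <= D} ->
  cell_coef r1 r2 (map g t) = cell_coef s1 s2 t.
Proof.
by move=> tD; rewrite /cell_coef ranks_natural // (sorted_natural r1g).
Qed.

Lemma cell_flag_natural t u : {subset t <= D} -> {subset u <= D} ->
  cell_flag r1 r2 (map g t) (map g u) = cell_flag s1 s2 t u.
Proof.
move=> tD uD; rewrite /cell_flag ranks_natural //; case: u uD => [|x [|y u]] //= uD.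
by rewrite (rank_natural r1g) 1?(rank_natural r2g) ?uD ?mem_head.
Qed.

Lemma pair_coef_natural t : {subset t <= D} ->
  pair_coef r1 r2 (map g t) = pair_coef s1 s2 t.
Proof.
by move=> tD; rewrite /pair_coef (sorted_natural r1g) // (sorted_natural r2g).
Qed.

Lemma pair_flag_natural t u : {subset t <= D} -> {subset u <= D} ->
  pair_flag r1 r2 (map g t) (map g u) = pair_flag s1 s2 t u.
Proof.
move=> tD uD; rewrite /pair_flag; case: u uD => [|x [|y [|z u]]] //= uD.
have xD : x \in D by rewrite uD ?inE ?eqxx.
have yD : y \in D by rewrite uD ?inE ?eqxx ?orbT.
by rewrite !(rank_natural r1g) // !(rank_natural r2g) // r1g // r2g.
Qed.

Lemma cell_sq_natural x : {subset x <= D} ->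
  cell_sq r1 r2 (map g x) = cell_sq s1 s2 x.
Proof.
move=> xD; have sub k l : {subset take k (drop l x) <= D}.
  by move=> a /mem_take/mem_drop/xD.
have sub0 k : {subset take k x <= D} by move=> a /mem_take/xD.
by rewrite /cell_sq -!map_drop -!map_take cell_coef_natural // !cell_flag_natural.
Qed.

Lemma pair_sq_natural x : {subset x <= D} ->
  pair_sq r1 r2 (map g x) = pair_sq s1 s2 x.
Proof.
move=> xD; have sub k l : {subset take k (drop l x) <= D}.
  by move=> a /mem_take/mem_drop/xD.
have sub0 k : {subset take k x <= D} by move=> a /mem_take/xD.
by rewrite /pair_sq -!map_drop -!map_take pair_coef_natural // !pair_flag_natural.
Qed.

Lemma monotone4_natural x : {subset x <= D} ->
  monotone4 r1 r2 (map g x) = monotone4 s1 s2 x.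
Proof.
move=> xD; have sub0 k : {subset take k x <= D} by move=> a /mem_take/xD.
rewrite /monotone4 -map_take (sorted_natural r1g) // (sorted_natural r2g) //.
by rewrite (@sorted_natural _ (fun a b => s2 b a)) // => a b aD bD; exact: r2g.
Qed.

End Naturality.

(** * Evaluation on permutations of seven points *)

Lemma get_memo (A : Type) (d : A) n k used (f : seq nat -> A) s :
  size s = k -> all (fun i => (i < n)%N) s -> uniq (used ++ s) ->
  get d (memo d n k used f) s = f s.
Proof.
elim: k s used f => [|k IHk] [|i s] //= used f [sk] /andP[ltin sn] us.
have iU : i \notin used.
  by apply: contraL us => iU; rewrite cat_uniq /= iU /= andbF.
rewrite (nth_map 0%N) ?size_iota // nth_iota // add0n (negPf iU) IHk //.
rewrite -cat_rcons in us; rewrite -(perm_uniq (s1 := rcons used i ++ s)) //.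
by rewrite perm_cat2r perm_rcons.
Qed.

Lemma sumZE (T : Type) (F : T -> Z) s : sumZ (map F s) = \sum_(x <- s) F x.
Proof. by elim: s => [|x s IHs]; rewrite ?big_nil // big_cons -IHs. Qed.

Fixpoint lexle (s t : seq nat) : bool :=
  match s, t with
  | i :: s', j :: t' => (i < j)%N || ((i == j) && lexle s' t')
  | [::], _ => true
  | _, _ => false
  end.

(** Turns a multiset identity between explicit lists into a computation by sorting, much cheaper
    than comparing the multiplicity of every entry. *)
Lemma perm_by_sort (s t : seq (seq nat)) : sort lexle s = sort lexle t -> perm_eq s t.
Proof.
by move=> st; rewrite -(perm_sort lexle s t) st perm_sort.
Qed.

Definition swap_last (k l : nat) (s : seq nat) : seq nat :=
  take k s ++ drop (k + l) s ++ take l (drop k s).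

(** An ordering with sorted labels is fixed by its last two entries, and [swap_last] supplies the
    other order of these. *)
Lemma cell_orders :
  perm_eq [seq s <- permutations (iota 0 7) | sorted ltn (take 5 s)]
    (cell_splits ++ map (swap_last 5 1) cell_splits).
Proof. by apply: perm_by_sort; vm_compute. Qed.

Definition pair_sorted (s : seq nat) :=
  [&& sorted ltn (take 2 s), sorted ltn (take 2 (drop 2 s)) & sorted ltn (take 2 (drop 4 s))].

(** The index [i] is the one left for the seventh entry, and [bump i] renumbers the six others
    around it. Exchanging the two extension pairs gives the second half of the list. *)
Lemma pair_orders :
  perm_eq [seq take 6 s | s <- [seq s <- permutations (iota 0 7) | pair_sorted s]]
    [seq map (bump i) s | i <- iota 0 7, s <- pair_splits ++ map (swap_last 2 2) pair_splits].
Proof. by apply: perm_by_sort; vm_compute. Qed.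

(** The multiplicity 6 = 3! comes from the orders of the three remaining points. *)
Lemma mono_orders :
  perm_eq [seq take 4 s | s <- [seq s <- permutations (iota 0 7) | sorted ltn (take 4 s)]]
    (flatten (nseq 6 (subseqs 4 7))).
Proof. by apply: perm_by_sort; vm_compute. Qed.

Lemma wdotC c a b : wdot c a b = wdot c b a.
Proof. by rewrite !wdotE; apply: eq_bigr => j _; rewrite mulrAC. Qed.

Lemma wdot0 c b : wdot c [::] b = 0.
Proof. by case: c. Qed.

Lemma sum_cat_map (R : pzSemiRingType) (I : eqType) (l : seq I) (h : I -> I) (F : I -> R) :
  {in l, forall s, F (h s) = F s} ->
  \sum_(s <- l ++ map h l) F s = 2%:R * \sum_(s <- l) F s.
Proof.
move=> Fh; rewrite big_cat big_map /= mulr_natl mulr2n; congr (_ + _).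
by rewrite big_seq [RHS]big_seq; apply: eq_bigr.
Qed.

Lemma sum_cell_sq q t5 :
  {in cell_splits, forall s, cell_sq ltn (byval q) s = cell_sq_fast t5 q s} ->
  \sum_(s <- permutations (iota 0 7)) cell_sq ltn (byval q) s =
  2%:R * \sum_(s <- cell_splits) cell_sq_fast t5 q s.
Proof.
move=> fastE.
rewrite (bigID (fun s => sorted ltn (take 5 s))) /= [X in _ + X]big1 => [|s /negPf ns]; last first.
  by rewrite /cell_sq /cell_coef ns.
rewrite addr0 -big_filter (perm_big _ cell_orders).
rewrite [LHS]sum_cat_map => [|s]; last first.
  have: all (fun s => size s == 7%N) cell_splits by vm_compute.
  move=> /allP ss /ss; case: s => [|a [|b [|c [|d [|e [|u [|v [|? ?]]]]]]]] // _.
  by rewrite /cell_sq /= wdotC.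
by congr (_ * _); rewrite [LHS]big_seq [RHS]big_seq; apply: eq_bigr.
Qed.

Lemma sum_pair_sq q :
  \sum_(s <- permutations (iota 0 7)) pair_sq ltn (byval q) s =
  \sum_(i <- iota 0 7) 2%:R * \sum_(s <- pair_splits) pair_sq ltn (byval q) (map (bump i) s).
Proof.
(* If one of the three pairs is out of order, either the coefficients or one of the two flags is the
   empty list, and the form vanishes. *)
rewrite (bigID pair_sorted) /= [X in _ + X]big1 => [|s ns]; last first.
  rewrite /pair_sq /pair_coef /pair_flag; move: ns; rewrite /pair_sorted.
  case: (sorted ltn (take 2 s)) => //=.
  case: (take 2 (drop 2 s)) => [|x [|y [|? ?]]]; rewrite ?wdot0 //= ?andbT.
  case: (x < y)%N; rewrite ?wdot0 //=.
  case: (take 2 (drop 4 s)) => [|z [|t [|? ?]]]; rewrite ?(wdotC _ _ [::]) ?wdot0 //= ?andbT.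
  by move=> /negPf ->; rewrite wdotC wdot0.
rewrite addr0 -big_filter.
have sq6 s : pair_sq ltn (byval q) (take 6 s) = pair_sq ltn (byval q) s.
  by case: s => [|a [|b [|c [|d [|e [|u [|v s]]]]]]] //; rewrite /pair_sq /= ?take0.
under eq_bigr do rewrite -sq6.
rewrite -(big_map (take 6) xpredT) (perm_big _ pair_orders).
transitivity (\sum_(i <- iota 0 7) \sum_(s <- pair_splits ++ map (swap_last 2 2) pair_splits)
    pair_sq ltn (byval q) (map (bump i) s)); first exact: big_allpairs_dep.
apply: eq_bigr => i _; apply: sum_cat_map => s.
have: all (fun s => size s == 6%N) pair_splits by vm_compute.
move=> /allP ss /ss; case: s => [|a [|b [|c [|d [|e [|u [|? ?]]]]]]] // _.
by rewrite /pair_sq /= wdotC.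
Qed.

Lemma sum_flatten_nseq (R : nmodType) (I : Type) n (l : seq I) (F : I -> R) :
  \sum_(s <- flatten (nseq n l)) F s = (\sum_(s <- l) F s) *+ n.
Proof.
by elim: n => [|n IHn]; rewrite ?big_nil //= big_cat IHn mulrS.
Qed.

Lemma sum_monotone4 q :
  \sum_(s <- permutations (iota 0 7)) (monotone4 ltn (byval q) s)%:R = 6%:R * mono_val q.
Proof.
rewrite (bigID (fun s => sorted ltn (take 4 s))) /= [X in _ + X]big1 => [|s /negPf ns]; last first.
  by rewrite /monotone4 ns.
rewrite addr0 -big_filter.
have m4 s : monotone4 ltn (byval q) (take 4 s) = monotone4 ltn (byval q) s.
  by rewrite /monotone4 take_takel.
under eq_bigr do rewrite -m4.
rewrite -(big_map (take 4) xpredT (fun s => (monotone4 ltn (byval q) s)%:R)).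
rewrite (perm_big _ mono_orders) [LHS]sum_flatten_nseq mulr_natl; congr (_ *+ _).
rewrite /mono_val; elim: (subseqs 4 7) => [|s l IHl]; rewrite ?big_nil // big_cons IHl /=.
by rewrite Nat2Z.inj_add; case: monotone4.
Qed.

Lemma count_ltn_iota m n : (m <= n)%N -> count (fun i => (i < m)%N) (iota 0 n) = m.
Proof.
by move=> le_mn; rewrite -size_filter (filter_iota_ltn 0 le_mn) size_iota.
Qed.

Lemma squareE (T : Type) (r1 r2 : rel T) x :
  square r1 r2 x = (45%Z : Z) * cell_sq r1 r2 x + (3%Z : Z) * pair_sq r1 r2 x.
Proof. by []. Qed.

(** * Correctness of the tables for a fixed pattern *)

Section OnePermutation.
Variable q : seq nat.
Hypothesis qP : perm_eq q (iota 0 7).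

Let size_q : size q = 7%N. Proof. by rewrite (perm_size qP) size_iota. Qed.
Let uniq_q : uniq q. Proof. by rewrite (perm_uniq qP) iota_uniq. Qed.

Let nth_q_lt i : (i < 7)%N -> (nth 0 q i < 7)%N.
Proof.
move=> ilt; have := mem_nth 0%N; rewrite -size_q in ilt => /(_ _ _ ilt).
by rewrite (perm_mem qP) mem_iota.
Qed.

Let nth_q_inj i j : (i < 7)%N -> (j < 7)%N -> nth 0%N q i = nth 0%N q j -> i = j.
Proof. by move=> ilt jlt /eqP; rewrite nth_uniq ?size_q // => /eqP. Qed.

Lemma count_byval m : (m <= 7)%N -> count (fun a => (nth 0 q a < m)%N) (iota 0 7) = m.
Proof.
move=> m7; rewrite -(count_map (nth 0%N q) (fun a => (a < m)%N)).
have -> : map (nth 0%N q) (iota 0 7) = q by rewrite -size_q map_nth_iota0 ?take_size.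
by have /seq.permP -> := qP; exact: count_ltn_iota.
Qed.

Lemma cell_sq_fastE : {in cell_splits, forall s,
  cell_sq ltn (byval q) s = cell_sq_fast cell_table q s}.
Proof.
have: all (fun s => perm_eq s (iota 0 7) && sorted ltn (take 5 s)) cell_splits by vm_compute.
move=> /allP + s => /[apply] /andP[sP sorted5].
have sz : size s = 7%N by rewrite (perm_size sP) size_iota.
pose u := nth 0%N s 5; pose v := nth 0%N s 6; pose t := take 5 s.
have sE : s = t ++ [:: u; v].
  by move: sz; rewrite /u /v /t; case: s {sP sorted5 u v t} => [|a [|b [|c [|d [|e [|? [|? [|? ?]]]]]]]].
have s_lt i : i \in s -> (i < 7)%N by rewrite (perm_mem sP) mem_iota.
have ult : (u < 7)%N by apply: s_lt; rewrite sE mem_cat !inE eqxx orbT.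
have vlt : (v < 7)%N by apply: s_lt; rewrite sE mem_cat !inE eqxx !orbT.
have tlt i : i \in t -> (i < 7)%N by move=> it; apply: s_lt; rewrite sE mem_cat it.
have sU : uniq s by rewrite (perm_uniq sP) iota_uniq.
have /and3P[tU tuv] : [&& uniq t, ~~ has (mem t) [:: u; v] & uniq [:: u; v]].
  by rewrite -cat_uniq -sE.
rewrite /= andbT inE => uv; move: tuv; rewrite /= orbF negb_or => /andP[ut vt].
(* The labels are all seven indices except [u] and [v]. Over all seven, ranks are known: [x] by
   position and [nth 0 q x] by value. *)
have count_t (p : pred nat) : count p t = (count p (iota 0 7) - p u - p v)%N.
  by rewrite -(seq.permP sP) sE count_cat /= addn0 -subnDA addnK.
have rank1 x : (x < 7)%N -> rank ltn t x = (x - (u < x) - (v < x))%N.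
  by move=> xlt; rewrite /rank count_t count_ltn_iota // ltnW.
have rank2 x : (x < 7)%N ->
    rank (byval q) t x = (nth 0 q x - (nth 0 q u < nth 0 q x) - (nth 0 q v < nth 0 q x))%N.
  by move=> xlt; rewrite /rank count_t /byval count_byval // ltnW // nth_q_lt.
have ranksE : map (rank (byval q) t) t = subranks q t u v.
  by apply/eq_in_map => x /tlt; exact: rank2.
have qu := nth_q_lt ult; have qv := nth_q_lt vlt.
have quv : nth 0%N q u != nth 0%N q v.
  by apply: contra uv => /eqP /(nth_q_inj ult vlt) /eqP.
(* The relative ranks are five distinct numbers below 5, since removing the values at [u] and [v]
   closes exactly the gaps they leave; so the lookup falls inside the table. *)
have getE : get ([::], [::]) cell_table (subranks q t u v) =
    assoc ([::], [::]) cell_flags (subranks q t u v).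
  apply: get_memo.
  - by rewrite size_map size_take sz.
  - apply/allP => _ /mapP[x xt ->] /=.
    have xlt := tlt _ xt; have := nth_q_lt xlt.
    have xu : nth 0%N q x != nth 0%N q u.
      by apply: contraNneq ut => /(nth_q_inj xlt ult) <-.
    have xv : nth 0%N q x != nth 0%N q v.
      by apply: contraNneq vt => /(nth_q_inj xlt vlt) <-.
    move: xu xv quv qu qv; lia.
  rewrite cat0s map_inj_in_uniq // => x y xt yt /=.
  have xlt := tlt _ xt; have ylt := tlt _ yt.
  have xu : nth 0%N q x != nth 0%N q u.
    by apply: contraNneq ut => /(nth_q_inj xlt ult) <-.
  have xv : nth 0%N q x != nth 0%N q v.
    by apply: contraNneq vt => /(nth_q_inj xlt vlt) <-.
  have yu : nth 0%N q y != nth 0%N q u.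
    by apply: contraNneq ut => /(nth_q_inj ylt ult) <-.
  have yv : nth 0%N q y != nth 0%N q v.
    by apply: contraNneq vt => /(nth_q_inj ylt vlt) <-.
  move=> xy; apply: nth_q_inj => //; move: xu xv yu yv quv xy; lia.
rewrite /cell_sq /cell_coef /cell_flag -/t sorted5 ranksE.
have -> : take 1 (drop 5 s) = [:: u] by rewrite sE drop_size_cat // size_take sz.
have -> : take 1 (drop 6 s) = [:: v].
  by rewrite sE -(drop_drop _ 1 5) drop_size_cat // size_take sz.
rewrite !rank1 // !rank2 // /cell_sq_fast -/u -/v -/t getE.
by case: (assoc _ _ _) => [[|c0 c] f] //=; rewrite !ltnn !subn0.
Qed.

Lemma remove_stdP i : (i < 7)%N ->
  [/\ size (remove_std q i) = 6%N, uniq (remove_std q i)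
    & all (fun x => (x < 6)%N) (remove_std q i)].
Proof.
move=> ilt; set x := nth 0%N q i.
have qE : q = take i q ++ x :: drop i.+1 q by rewrite -drop_nth ?size_q // cat_take_drop.
pose r := take i q ++ drop i.+1 q.
have rq : perm_eq q (x :: r) by rewrite {1}qE -cat1s perm_catCA.
have sr : size r = 6%N by apply: succn_inj; rewrite -[LHS]/(size (x :: r)) -(perm_size rq).
have /andP[xr rU] : uniq (x :: r) by rewrite -(perm_uniq rq).
have rlt y : y \in r -> (y < 7)%N.
  by move=> yr; have := perm_mem qP y; rewrite (perm_mem rq) inE yr orbT mem_iota.
have xlt : (x < 7)%N by apply: nth_q_lt.
split; first by rewrite size_map.
  rewrite map_inj_in_uniq // => y z yr zr.
  have yx : y != x by apply: contraNneq xr => <-.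
  have zx : z != x by apply: contraNneq xr => <-.
  by move: yx zx; rewrite -/x; lia.
apply/allP => _ /mapP[y yr ->].
have yx : y != x by apply: contraNneq xr => <-.
by move: yx (rlt _ yr); rewrite -/x; lia.
Qed.

(** [bump i] is increasing and skips [i], while lowering the values above the removed one keeps the
    order of the others, so both orders are respected on six indices. *)
Lemma pair_sq_remove i s : (i < 7)%N -> perm_eq s (iota 0 6) ->
  pair_sq ltn (byval q) (map (bump i) s) = pair_sq ltn (byval (remove_std q i)) s.
Proof.
move=> ilt sP; apply: (@pair_sq_natural _ _ (bump i) (fun a => a < 6)%N).
- by move=> a b _ _ /=; rewrite /bump; lia.
- move=> a b alt blt; rewrite !unfold_in in alt blt.
  have [szr _ _] := remove_stdP ilt.
  have nthr j : (j < 6)%N -> nth 0%N (remove_std q i) j =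
      (nth 0 q (bump i j) - (nth 0 q i < nth 0 q (bump i j)))%N.
    move=> jlt; rewrite (nth_map 0%N); last by rewrite -(size_map (fun v => v - (nth 0%N q i < v))%N) szr.
    suff -> : nth 0%N (take i q ++ drop i.+1 q) j = nth 0%N q (bump i j) by [].
    rewrite nth_cat size_takel ?size_q; last exact: ltnW.
    have [ji|ij] := ltnP j i; first by rewrite nth_take // /bump leqNgt ji.
    by rewrite nth_drop /bump ij; congr nth; lia.
  rewrite /byval !nthr //.
  have ne j : (j < 6)%N -> nth 0%N q (bump i j) != nth 0%N q i.
    move=> jlt; apply/eqP => /nth_q_inj E; have: bump i j = i by apply: E => //; rewrite /bump; lia.
    by rewrite /bump; lia.
  by move: (ne _ alt) (ne _ blt); lia.
by move=> a; rewrite (perm_mem sP) mem_iota.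
Qed.

(** Gives the table entry its meaning: it is the sum of [square] over all 5040 orderings of the
    points of the pattern [q]. *)
Lemma sum_square :
  \sum_(s <- permutations (iota 0 7)) square ltn (byval q) s = get 0 square_table q.
Proof.
transitivity ((45%Z : Z) * (2%:R * \sum_(s <- cell_splits) cell_sq_fast cell_table q s) +
  (3%Z : Z) * \sum_(i <- iota 0 7) get 0%Z pair_table (remove_std q i)); last first.
  rewrite get_memo ?size_q //; first by rewrite /square_val !sumZE.
  by apply/allP => x; rewrite (perm_mem qP) mem_iota.
rewrite (eq_bigr _ (fun s _ => squareE _ _ s)) -(sum_cell_sq cell_sq_fastE) big_split /= -!mulr_sumr; congr (_ * _ + _ * _).
rewrite sum_pair_sq big_seq [RHS]big_seq; apply: eq_bigr => i; rewrite mem_iota => /= ilt.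
have [sz U lt6] := remove_stdP ilt.
rewrite get_memo // /pair_val sumZE.
suff -> : \sum_(s <- pair_splits) pair_sq ltn (byval q) (map (bump i) s) =
    \sum_(s <- pair_splits) pair_sq ltn (byval (remove_std q i)) s by [].
have: all (fun s => perm_eq s (iota 0 6)) pair_splits by vm_compute.
by move=> /allP P; rewrite big_seq [RHS]big_seq; apply: eq_bigr => s /P; exact: pair_sq_remove.
Qed.

End OnePermutation.

(** * Symmetries *)

(** All 5040 inequalities are evaluated by the kernel; [vm_cast_no_check] leaves the computation to
    [Qed], so it runs only once. *)
Lemma square_table_certified : all_certified square_table.
Proof. by vm_cast_no_check (erefl true). Qed.

Lemma scale_ge1 : (1 <= scale)%Z. Proof. by []. Qed.

(* Keeps unification from evaluating the tables. *)
#[local] Opaque square_table scale square.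

Definition conv (T : Type) (r : rel T) : rel T := fun a b => r b a.

(** The symmetry group of the square acts on a pair of orders by reversing either of them and by
    exchanging the two. *)
Definition views (T : Type) (r1 r2 : rel T) : seq (rel T * rel T) :=
  flatten [seq [:: (p.1, p.2); (p.1, conv p.2); (conv p.1, p.2); (conv p.1, conv p.2)]
    | p <- [:: (r1, r2); (r2, r1)]].

Definition view_square (T : Type) (r1 r2 : rel T) (i : nat) (x : seq T) : Z :=
  let v := nth (r1, r2) (views r1 r2) i in square v.1 v.2 x.

Lemma sum_affine (R : pzRingType) (I J : Type) (l : seq I) (m : seq J) (a b c : R)
    (f : I -> R) (F : J -> I -> R) :
  \sum_(z <- l) (a * f z - b - c * \sum_(v <- m) F v z) =
  a * (\sum_(z <- l) f z) - b *+ size l - c * \sum_(v <- m) \sum_(z <- l) F v z.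
Proof.
by rewrite !sumrB -!mulr_sumr exchange_big big_const_seq count_predT iter_addr_0.
Qed.

Section Realizes.
Variables (T : eqType) (x0 : T).
Implicit Types (r : rel T) (y : seq T) (q : seq nat).

(** [y] lists seven points by position and [q] is their permutation pattern: comparing entries of
    [q] compares the points by value. *)
Record realizes r1 r2 y q : Prop := Realizes {
  realizes_size : size y = 7%N;
  realizes_uniq : uniq y;
  realizes_perm : perm_eq q (iota 0 7);
  realizes_pos : {in gtn 7%N &, forall i j, r1 (nth x0 y i) (nth x0 y j) = (i < j)%N};
  realizes_val : {in gtn 7%N &, forall i j, r2 (nth x0 y i) (nth x0 y j) = byval q i j} }.

Lemma realizes_complement r1 r2 y q :
  realizes r1 r2 y q -> realizes r1 (conv r2) y (complement q).
Proof.
case=> sy yU qP r1P r2P; have sq : size q = 7%N by rewrite (perm_size qP) size_iota.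
have q_lt i : i \in gtn 7%N -> (nth 0 q i < 7)%N.
  rewrite unfold_in /= -[X in (_ < X)%N -> _]sq => /(mem_nth 0%N).
  by rewrite (perm_mem qP) mem_iota.
split => //.
  by apply: (perm_trans (perm_map _ qP)); rewrite sq.
move=> i j ilt jlt; rewrite /conv r2P // /byval /complement sq.
rewrite !(nth_map 0%N) ?sq //; have := q_lt _ ilt; have := q_lt _ jlt; lia.
Qed.

Lemma realizes_rev r1 r2 y q : realizes r1 r2 y q -> realizes (conv r1) r2 (rev y) (rev q).
Proof.
case=> sy yU qP r1P r2P; have sq : size q = 7%N by rewrite (perm_size qP) size_iota.
have rev_lt i : (7 - i.+1 \in gtn 7%N)%N by rewrite unfold_in /=; lia.
split; rewrite ?size_rev ?rev_uniq // ?perm_rev //.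
  move=> i j ilt jlt; rewrite /conv !nth_rev ?sy // r1P ?rev_lt //.
  by move: ilt jlt; rewrite !unfold_in /=; lia.
by move=> i j ilt jlt; rewrite /byval !nth_rev ?sy ?sq // r2P ?rev_lt.
Qed.

Lemma perm_inversep q : perm_eq q (iota 0 7) -> perm_eq (inversep q) (iota 0 7).
Proof.
move=> qP; have sq : size q = 7%N by rewrite (perm_size qP) size_iota.
have qU : uniq q by rewrite (perm_uniq qP) iota_uniq.
have iq i : i \in iota 0 7 -> i \in q by rewrite (perm_mem qP).
have iU : uniq (inversep q).
  rewrite map_inj_in_uniq ?iota_uniq // sq => i j /iq iq' /iq jq' E.
  by rewrite -(nth_index 0%N iq') E nth_index.
apply: uniq_perm; rewrite ?iota_uniq //.
apply: (uniq_min_size iU _ _).2; last by rewrite size_map !size_iota sq.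
by move=> x /mapP[i]; rewrite sq => /iq iq' ->; rewrite mem_iota /= add0n -sq index_mem.
Qed.

(** Exchanging the orders inverts the pattern, and the points have to be listed anew, by their
    former values. *)
Lemma realizes_inverse r1 r2 y q :
  realizes r1 r2 y q -> realizes r2 r1 (map (nth x0 y) (inversep q)) (inversep q).
Proof.
case=> sy yU qP r1P r2P; have sq : size q = 7%N by rewrite (perm_size qP) size_iota.
have iP := perm_inversep qP.
have mem i : i \in gtn 7%N -> i \in q by rewrite (perm_mem qP) mem_iota.
have nthE i : i \in gtn 7%N -> nth 0%N (inversep q) i = index i q.
  by move=> ilt; rewrite (nth_map 0%N) ?size_iota ?sq // nth_iota.
have index_lt i : i \in gtn 7%N -> index i q \in gtn 7.
  by move=> /mem; rewrite -index_mem sq.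
have size_i : size (inversep q) = 7%N by rewrite (perm_size iP) size_iota.
split; rewrite ?size_map ?size_iota ?sq //.
- rewrite map_inj_in_uniq ?(perm_uniq iP) ?iota_uniq // => i j.
  rewrite !(perm_mem iP) !mem_iota /= -sy => ilt jlt /eqP.
  by rewrite nth_uniq // => /eqP.
- move=> i j ilt jlt; rewrite !(nth_map 0%N x0 (nth x0 y)) ?size_i // !nthE // r2P ?index_lt //.
  by rewrite /byval !nth_index ?mem.
by move=> i j ilt jlt; rewrite !(nth_map 0%N x0 (nth x0 y)) ?size_i // /byval !nthE // r1P ?index_lt.
Qed.

Lemma sum_permutations (R : nmodType) y (F : seq T -> R) : uniq y ->
  \sum_(z <- permutations y) F z =
  \sum_(s <- permutations (iota 0 (size y))) F (map (nth x0 y) s).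
Proof. by move=> yU; rewrite (perm_big _ (perm_permutations_nth x0 yU)) big_map. Qed.

Lemma sum_square_realizes r1 r2 y q : realizes r1 r2 y q ->
  \sum_(z <- permutations y) square r1 r2 z = get 0 square_table q.
Proof.
case=> sy yU qP r1P r2P; rewrite sum_permutations // sy -(sum_square qP).
rewrite big_seq [RHS]big_seq; apply: eq_bigr => s; rewrite mem_permutations => sP.
have sD : {subset s <= gtn 7%N} by move=> i; rewrite (perm_mem sP) mem_iota.
by rewrite !squareE (cell_sq_natural r1P r2P) ?(pair_sq_natural r1P r2P).
Qed.

(** Each view of the points realizes the corresponding image of [q], possibly with the points listed
    differently; the sum over all orderings does not see the listing. *)
Lemma sum_views r1 r2 y q : realizes r1 r2 y q ->
  \sum_(i <- iota 0 8) \sum_(z <- permutations y) view_square r1 r2 i z =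
  \sum_(p <- images q) get 0 square_table p.
Proof.
move=> H; have Hi := realizes_inverse H.
have iy : perm_eq (map (nth x0 y) (inversep q)) y.
  have [sy _ qP _ _] := H.
  by apply: (perm_trans (perm_map _ (perm_inversep qP))); rewrite -sy map_nth_iota0 ?take_size.
have sumP r1' r2' y' q' : perm_eq y' y -> realizes r1' r2' y' q' ->
    \sum_(z <- permutations y) square r1' r2' z = get 0 square_table q'.
  by move=> /perm_permutations yP /sum_square_realizes <-; rewrite (perm_big _ yP).
have ry y' : perm_eq y' y -> perm_eq (rev y') y by rewrite perm_rev.
rewrite /view_square /views /images /= !big_cons !big_nil /=.
congr (_ + (_ + (_ + (_ + (_ + (_ + (_ + (_ + _)))))))).
- exact: (sumP _ _ _ _ (perm_refl y) H).
- exact: (sumP _ _ _ _ (perm_refl y) (realizes_complement H)).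
- exact: (sumP _ _ _ _ (ry _ (perm_refl y)) (realizes_rev H)).
- exact: (sumP _ _ _ _ (ry _ (perm_refl y)) (realizes_complement (realizes_rev H))).
- exact: (sumP _ _ _ _ iy Hi).
- exact: (sumP _ _ _ _ iy (realizes_complement Hi)).
- exact: (sumP _ _ _ _ (ry _ iy) (realizes_rev Hi)).
exact: (sumP _ _ _ _ (ry _ iy) (realizes_complement (realizes_rev Hi))).
Qed.

(** Here 648 = 27 * 24, where 24 accounts for quadruples being taken in order of position. Summed
    over the orderings of seven points, this is 9 times the slack in [certified]. *)
Definition defect r1 r2 (x : seq T) : Z :=
  ((648%Z : Z) * scale * (monotone4 r1 r2 x)%:R - scale
   - (9%Z : Z) * \sum_(i <- iota 0 8) view_square r1 r2 i x)%R.

Lemma sum_defect_ge0 r1 r2 y q : realizes r1 r2 y q ->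
  0 <= \sum_(z <- permutations y) defect r1 r2 z.
Proof.
move=> H; have [sy yU qP r1P r2P] := H.
have E := sum_affine (permutations y) (iota 0 8) ((648%Z : Z) * scale) scale (9%Z : Z)
  (fun z => (monotone4 r1 r2 z)%:R) (view_square r1 r2).
have -> : \sum_(z <- permutations y) defect r1 r2 z = _ := E.
rewrite (sum_views H) size_permutations // sy.
have -> : \sum_(z <- permutations y) (monotone4 r1 r2 z)%:R = 6%:R * mono_val q :> Z.
  rewrite sum_permutations // sy -sum_monotone4.
  rewrite big_seq [RHS]big_seq; apply: eq_bigr => s; rewrite mem_permutations => sP.
  have sD : {subset s <= gtn 7%N} by move=> i; rewrite (perm_mem sP) mem_iota.
  by rewrite (monotone4_natural r1P r2P).
have -> : scale *+ 7`! = (5040%Z : Z) * scale.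
  by rewrite -mulr_natl; congr (_ * _); vm_compute.
have : certified square_table q.
  by have /allP := square_table_certified; apply; rewrite mem_permutations.
rewrite /certified sumZE => /Z.leb_le.
rewrite -[\sum_(p <- images q) get 0%Z _ _]/(\sum_(p <- images q) get 0 square_table p).
(* The certified inequality is multiplied by 9: 648 * 6 = 9 * 432 and 5040 = 9 * 560. *)
move: (\sum_(p <- images q) _) (mono_val q) scale => s m d; lia.
Qed.

End Realizes.

(** * Counting in a permutation graph *)

(** Standardization of a list of distinct numbers. Strict monotonicity of the rank holds because [x]
    itself is counted below any larger number. *)
Lemma ranks_perm_iota (w : seq nat) : uniq w ->
  let rk x := count (fun z => (z < x)%N) w in
  perm_eq (map rk w) (iota 0 (size w)) /\ {in w &, forall x z, (rk x < rk z)%N = (x < z)%N}.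
Proof.
move=> wU rk.
have rk_le x z : (x <= z)%N -> (rk x <= rk z)%N.
  by move=> xz; apply: sub_count => a /= ax; exact: leq_trans ax xz.
have rk_lt x z : x \in w -> (x < z)%N -> (rk x < rk z)%N.
  move=> xw xz; apply: (@leq_trans (rk x.+1)); last exact: rk_le.
  rewrite /rk -(addn1 (count _ w)).
  have <- : count (pred1 x) w = 1%N by rewrite count_uniq_mem // xw.
  rewrite -count_predUI [X in (_ + X)%N](_ : _ = 0%N).
    by rewrite addn0; apply: sub_count => a /=; lia.
  by apply/eqP; rewrite -leqn0 leqNgt -has_count; apply/hasPn => a _ /=; case: ltngtP.
have rkE : {in w &, forall x z, (rk x < rk z)%N = (x < z)%N}.
  move=> x z xw zw; apply/idP/idP; last exact: rk_lt.
  by apply: contraTT; rewrite -!leqNgt; exact: rk_le.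
split=> //.
have rkU : uniq (map rk w).
  rewrite map_inj_in_uniq // => x z xw zw E.
  by case: (ltngtP x z) => // [/(rk_lt _ _ xw)|/(rk_lt _ _ zw)]; rewrite E ltnn.
apply: uniq_perm => //; first exact: iota_uniq.
apply: (uniq_min_size rkU _ _).2; last by rewrite size_map size_iota.
move=> i /mapP[x xw ->]; rewrite mem_iota /= add0n /rk ltn_neqAle count_size andbT.
by rewrite -all_count; apply/allPn; exists x; rewrite ?ltnn.
Qed.

Section PermutationGraph.
Variables (n : nat) (tau : 'S_n).

Let r1 : rel 'I_n := fun i j => (i < j)%N.
Let r2 : rel 'I_n := fun i j => (tau i < tau j)%N.

Lemma sorted_realizes x0 y : uniq y -> size y = 7%N -> sorted r1 y ->
  exists q, realizes x0 r1 r2 y q.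
Proof.
move=> yU sy ysort.
pose w := [seq nat_of_ord (tau i) | i <- y].
have wU : uniq w by rewrite map_inj_uniq // => i j /val_inj/perm_inj.
have [] := ranks_perm_iota wU; set rk := (fun x => _) => qP rkE.
exists (map rk w); split=> //; first by rewrite size_map sy in qP.
  move=> i j; rewrite !unfold_in /= -!sy => ilt jlt.
  have lt_sorted a b : (a < b < size y)%N -> r1 (nth x0 y a) (nth x0 y b).
    move=> /andP[ab bs]; have r1T : transitive r1 by move=> u v t; exact: ltn_trans.
    by apply: (sorted_ltn_nth r1T) => //; rewrite inE //; exact: ltn_trans bs.
  have [ij|ji|->] := ltngtP i j; last by rewrite /r1 ltnn.
    by apply: lt_sorted; rewrite ij jlt.
  apply/negbTE; rewrite -leqNgt ltnW //; by apply: lt_sorted; rewrite ji ilt.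
move=> i j; rewrite !unfold_in /= -!sy => ilt jlt; rewrite /byval.
have sw : size w = size y by rewrite size_map.
by rewrite !(nth_map 0%N) ?sw // rkE ?mem_nth ?sw // !(nth_map x0).
Qed.

Lemma sum_uniq_defect_ge0 : 0 <= \sum_(x : 7.-tuple 'I_n | uniq x) defect r1 r2 x.
Proof.
apply: sum_uniq_ge0 => y yU sy ysort.
case: y yU sy ysort => // x0 y yU sy ysort.
by have [q qP] := sorted_realizes x0 yU sy ysort; exact: (sum_defect_ge0 qP).
Qed.

End PermutationGraph.

(** * Squares over all tuples, coinciding points allowed *)

Definition squares (T : Type) (r1 r2 : rel T) (x : seq T) : Z :=
  (\sum_(i <- iota 0 8) view_square r1 r2 i x)%R.

Lemma sum_squares_ge0 (T : finType) (r1 r2 : rel T) :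
  0 <= \sum_(x : 7.-tuple T) squares r1 r2 x.
Proof.
rewrite exchange_big; apply: sumr_ge0 => i _.
rewrite (eq_bigr _ (fun x _ => squareE _ _ _)) big_split /= -!mulr_sumr.
by rewrite addr_ge0 // mulr_ge0 ?sum_cell_sq_ge0 ?sum_pair_sq_ge0.
Qed.

Lemma square_natural (S T : eqType) (g : S -> T) (r1 r2 : rel T) (s1 s2 : rel S) x :
  (forall a b, r1 (g a) (g b) = s1 a b) -> (forall a b, r2 (g a) (g b) = s2 a b) ->
  square r1 r2 (map g x) = square s1 s2 x.
Proof.
move=> r1g r2g; rewrite !squareE.
by rewrite (@cell_sq_natural _ _ g predT _ _ s1 s2) ?(@pair_sq_natural _ _ g predT _ _ s1 s2).
Qed.

Lemma squares_natural (S T : eqType) (g : S -> T) (r1 r2 : rel T) (s1 s2 : rel S) x :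
  (forall a b, r1 (g a) (g b) = s1 a b) -> (forall a b, r2 (g a) (g b) = s2 a b) ->
  squares r1 r2 (map g x) = squares s1 s2 x.
Proof.
move=> r1g r2g.
have c1 a b : conv r1 (g a) (g b) = conv s1 a b by rewrite /conv r1g.
have c2 a b : conv r2 (g a) (g b) = conv s2 a b by rewrite /conv r2g.
rewrite /squares /view_square /= !big_cons !big_nil /=.
by congr (_ + (_ + (_ + (_ + (_ + (_ + (_ + (_ + _)))))))); apply: square_natural.
Qed.

Lemma squares_bounded : exists2 K : Z, 0 <= K &
  forall (T : finType) (r1 r2 : rel T) (x : 7.-tuple T), squares r1 r2 x <= K.
Proof.
(* [squares] only depends on the restrictions of [r1] and [r2] to the points of [x],
   which leaves finitely many values, for all [T] together. *)
pose relF := {ffun 'I_7 * 'I_7 -> bool}.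
pose W (f : relF * relF) := squares (fun a b => f.1 (a, b)) (fun a b => f.2 (a, b)) (enum 'I_7).
exists (\sum_f `|W f|); first exact: sumr_ge0.
move=> T r1 r2 x.
pose f : relF * relF := ([ffun p => r1 (tnth x p.1) (tnth x p.2)],
                         [ffun p => r2 (tnth x p.1) (tnth x p.2)]).
have -> : squares r1 r2 x = W f.
  have {1}-> : tval x = map (tnth x) (enum 'I_7) by rewrite map_tnth_enum.
  by apply: squares_natural => a b; rewrite ffunE.
by rewrite (bigD1 f) //= (le_trans (ler_norm _)) // lerDl sumr_ge0.
Qed.

(** * Monotone quadruples as induced subgraphs *)

Section CountMonotone.
Variables (n : nat) (G : rel 'I_n) (tau sigma : 'S_n).
Hypothesis G_perm : forall i j, G i j = perm_graph tau (sigma i) (sigma j).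

Let r1 : rel 'I_n := fun i j => (i < j)%N.
Let r2 : rel 'I_n := fun i j => (tau i < tau j)%N.

Let r1_trans : transitive r1. Proof. by move=> i j k; exact: ltn_trans. Qed.
Let r2_trans : transitive r2. Proof. by move=> i j k; exact: ltn_trans. Qed.

Lemma sorted_tnth (r : rel 'I_n) (t : 4.-tuple 'I_n) (a b : 'I_4) :
  transitive r -> sorted r t -> (a < b)%N -> r (tnth t a) (tnth t b).
Proof.
move=> rT tr ab; have := sorted_ltn_nth rT (tnth t a) tr.
by move=> /(_ a b); rewrite !inE size_tuple !ltn_ord -!tnth_nth; apply.
Qed.

(** The underlying set of [t], pulled back along the isomorphism [sigma], induces a copy of [H]; it
    determines [t], because [t] is sorted by position. *)
Lemma card_tuples_Pcount (H : rel 'I_4) (A : {set 4.-tuple 'I_n}) :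
  (forall t : 4.-tuple 'I_n, t \in A ->
     sorted r1 t /\ forall a b, H a b = perm_graph tau (tnth t a) (tnth t b)) ->
  (#|A| <= Pcount H G)%N.
Proof.
move=> AH; pose U (t : 4.-tuple 'I_n) := [set (sigma^-1)%g i | i in tval t].
have uniqA t : t \in A -> uniq t.
  by move=> /AH[tr _]; apply: sorted_uniq tr => // i; rewrite /r1 ltnn.
rewrite -(card_in_imset (f := U)).
  apply: subset_leq_card; apply/subsetP => _ /imsetP[t tA ->].
  have [tr tH] := AH t tA; rewrite inE; apply/andP; split.
    by rewrite card_imset; [rewrite (card_uniqP (uniqA t tA)) size_tuple | exact: perm_inj].
  apply/existsP; exists [ffun a => (sigma^-1)%g (tnth t a)].
  apply/andP; split; last first.
    by apply/'forall_forallP => a b; rewrite !ffunE G_perm !permKV tH.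
  apply/andP; split.
    apply/injectiveP => a b; rewrite !ffunE => /perm_inj.
    by have /tuple_uniqP := uniqA t tA; apply.
  apply/eqP/setP => i; apply/imsetP/imsetP => [[a _ ->]|[j jt ->]].
    by exists (tnth t a); rewrite ?ffunE // mem_tnth.
  by have /tnthP[a ->] := jt; exists a; rewrite ?ffunE.
move=> t u tA uA /setP E; apply: val_inj.
apply: (irr_sorted_eq r1_trans) => [i|||i]; first by rewrite /r1 ltnn.
- by have [] := AH _ tA.
- by have [] := AH _ uA.
have := E ((sigma^-1)%g i); rewrite /U !mem_imset //; exact: perm_inj.
Qed.

(** Edges are inversions, so decreasing quadruples give cliques and increasing ones give independent
    sets. *)
Lemma card_monotone4 :
  (#|[set t : 4.-tuple 'I_n | monotone4 r1 r2 t]| <= Pcount K4 G + Pcount empty4 G)%N.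
Proof.
pose dec := [set t : 4.-tuple 'I_n | sorted r1 t && sorted (fun a b => r2 b a) t].
pose inc := [set t : 4.-tuple 'I_n | sorted r1 t && sorted r2 t].
have /subset_leq_card : [set t : 4.-tuple 'I_n | monotone4 r1 r2 t] \subset dec :|: inc.
  apply/subsetP => t; rewrite !inE /monotone4 take_oversize ?size_tuple //.
  by case: sorted => //=; rewrite orbC.
move=> /leq_trans; apply; rewrite cardsU (leq_trans (leq_subr _ _)) // leq_add //.
  apply: card_tuples_Pcount => t; rewrite inE => /andP[t1 t2]; split=> // a b.
  have t2T : transitive (fun a b => r2 b a) by move=> i j k ij jk; exact: r2_trans jk ij.
  rewrite /K4 /perm_graph; have [ab|ba|/val_inj->] := ltngtP a b.
  - have := sorted_tnth r1_trans t1 ab; have := sorted_tnth t2T t2 ab.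
    by rewrite /r1 /r2 => -> ->; rewrite neq_ltn ab.
  - have := sorted_tnth r1_trans t1 ba; have := sorted_tnth t2T t2 ba.
    by rewrite /r1 /r2 => -> ->; rewrite orbT neq_ltn ba orbT.
  by rewrite eqxx !ltnn.
apply: card_tuples_Pcount => t; rewrite inE => /andP[t1 t2]; split=> // a b.
rewrite /empty4 /perm_graph; have [ab|ba|/val_inj->] := ltngtP a b.
- have := sorted_tnth r1_trans t1 ab; have := sorted_tnth r2_trans t2 ab.
  by rewrite /r1 /r2; lia.
- have := sorted_tnth r1_trans t1 ba; have := sorted_tnth r2_trans t2 ba.
  by rewrite /r1 /r2; lia.
by rewrite !ltnn.
Qed.

End CountMonotone.

(** * Error terms and the passage to densities *)

(** A union bound over the pairs of coordinates that may coincide; for seven points there are 21 of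
    them. *)
Lemma expn_ffact n k : (n ^ k.+1 <= n ^_ k.+1 + 'C(k.+1, 2) * n ^ k)%N.
Proof.
elim: k => [|k IHk]; first by rewrite ffactn1 expn1 leq_addr.
rewrite ffactnSr binS bin1 expnSr (leq_trans (leq_mul IHk (leqnn n))) //.
have le_ff : (n ^_ k.+1 <= n ^ k.+1)%N.
  by elim: k.+1 => // j; rewrite ffactnSr expnSr => IHj; rewrite leq_mul ?leq_subr.
have : (n ^_ k.+1 * n <= n ^_ k.+1 * (n - k.+1) + k.+1 * n ^ k.+1)%N.
  have : (n <= n - k.+1 + k.+1)%N by rewrite addnC -leq_subLR.
  move=> /(leq_mul (leqnn (n ^_ k.+1))) /leq_trans; apply.
  by rewrite mulnDr leq_add2l mulnC leq_mul.
rewrite !expnSr; nia.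
Qed.

Lemma sum_uniq_const (n : nat) (c : Z) :
  \sum_(x : 7.-tuple 'I_n | uniq x) c = c *+ n ^_ 7.
Proof.
rewrite sumr_const -[n in n ^_ 7]card_ord -card_uniq_tuples; congr (_ *+ _).
by apply: eq_card => x; rewrite !inE all_predT.
Qed.

Lemma sum_monotone4_tuples (n : nat) (r1 r2 : rel 'I_n) :
  \sum_(x : 7.-tuple 'I_n) (monotone4 r1 r2 x)%:R =
  (#|[set t : 4.-tuple 'I_n | monotone4 r1 r2 t]| * n ^ 3)%:R :> Z.
Proof.
rewrite (sum_tuple_cat 4 3 (fun x => (monotone4 r1 r2 x)%:R)).
rewrite natrM -sum1_card natr_sum mulr_suml [RHS]big_mkcond /=.
apply: eq_bigr => t _; rewrite inE.
have E (u : 3.-tuple 'I_n) : monotone4 r1 r2 (t ++ u) = monotone4 r1 r2 t.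
  by rewrite /monotone4 !take_size_cat ?size_tuple // take_oversize ?size_tuple.
under eq_bigr do rewrite E.
rewrite sumr_const card_tuple card_ord.
by case: monotone4; rewrite ?mul0rn ?mul1r.
Qed.

(** Read [D] as [scale], [N] as n^4, [c] as n^3 and [F] as the number of injective 7-tuples; [a] and
    [S] are the sums of monotone indicators and of squares over these. Replacing [F] by [N * c]
    costs a multiple of [c * c]; then one divides by [c] and by [D]. *)
Lemma count_arithmetic (D K M F N c a S : Z) :
  (1 <= D -> 0 <= K -> 0 < c -> 0 <= M -> a <= M * c -> - (K * (N * c - F)) <= S ->
   N * c <= F + 21 * (c * c) -> 0 <= 648 * D * a - D * F - 9 * S ->
   N <= 648 * M + 21 * (9 * K + D) * c)%Z.
Proof.
move=> D1 K0 c0 M0 aM SK NF H.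
have aD : (D * a <= D * (M * c))%Z by nia.
have KN : (K * (N * c - F) <= K * (21 * (c * c)))%Z by nia.
have DN : (D * (N * c) <= D * (F + 21 * (c * c)))%Z by nia.
have DNM : (D * N <= 648 * (D * M) + 21 * (9 * K + D) * c)%Z.
  by apply/(Z.mul_le_mono_pos_l _ _ c c0); nia.
have D0 : (0 < D)%Z by lia.
by apply/(Z.mul_le_mono_pos_l _ _ D D0); nia.
Qed.

Lemma monotone4_count : exists L : nat, forall n (G : rel 'I_n), admissible G ->
  (n ^ 4 <= 648 * (Pcount K4 G + Pcount empty4 G) + L * n ^ 3)%N.
Proof.
have [K K_ge0 bound] := squares_bounded.
exists (Z.to_nat (21 * (9 * K + scale))%Z) => n G [tau [sigma G_perm]].
set M := (Pcount K4 G + _)%N.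
pose r1 : rel 'I_n := fun i j => (i < j)%N.
pose r2 : rel 'I_n := fun i j => (tau i < tau j)%N.
have := sum_uniq_defect_ge0 tau; rewrite -/r1 -/r2.
rewrite /defect !sumrB -!mulr_sumr sum_uniq_const => H.
have mono_le : \sum_(x : 7.-tuple 'I_n | uniq x) (monotone4 r1 r2 x)%:R <= (M * n ^ 3)%:R :> Z.
  apply: (@le_trans _ _ (\sum_(x : 7.-tuple 'I_n) (monotone4 r1 r2 x)%:R)).
    by rewrite [leRHS](bigID (fun x => uniq (tval x))) /= lerDl sumr_ge0.
  rewrite sum_monotone4_tuples ler_nat; apply: leq_mul => //; exact: card_monotone4 G_perm.
(* The sum of squares over all tuples is nonnegative, and each tuple with a repeated point
   contributes at most [K] to it. *)
have sq_ge : - (K * ((n ^ 7)%:R - (n ^_ 7)%:R)) <= \sum_(x : 7.-tuple 'I_n | uniq x) squares r1 r2 x.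
  have all_ge0 := sum_squares_ge0 r1 r2.
  rewrite (bigID (fun x => uniq (tval x))) /= in all_ge0.
  have le_K : \sum_(x : 7.-tuple 'I_n | ~~ uniq x) squares r1 r2 x <=
      \sum_(x : 7.-tuple 'I_n | ~~ uniq x) K by apply: ler_sum => x _; exact: bound.
  have : \sum_(x : 7.-tuple 'I_n) K = K *+ n ^ 7 by rewrite sumr_const card_tuple card_ord.
  rewrite (bigID (fun x => uniq (tval x))) /= sum_uniq_const.
  rewrite -[K *+ n ^ 7]mulr_natr -[K *+ n ^_ 7]mulr_natr.
  move=> E; rewrite mulrBr -E [X in - (X - _)]addrC addrK lerNl; apply: le_trans le_K.
  by rewrite -subr_ge0 opprK addrC.
have [->|n_gt0] := posnP n; first by rewrite exp0n.
have nE : (n ^ 7)%:R = (n ^ 4)%:R * (n ^ 3)%:R :> Z by rewrite -natrM -expnD.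
have n6 : (21 * n ^ 6)%:R = 21%Z * ((n ^ 3)%:R * (n ^ 3)%:R) :> Z.
  by rewrite natrM (expnD n 3 3) natrM.
(* Translates ring-style numerals into [Z.of_nat], so that [lia] can read them. *)
have of_nat k : k%:R = Z.of_nat k by elim: k => // k IHk; rewrite mulrS IHk; lia.
have nc : (0 < (n ^ 3)%:R :> Z) by rewrite ltr0n expn_gt0 n_gt0.
have L_ge0 : (0 <= 21 * (9 * K + scale))%Z by move/Z.leb_le: K_ge0; have := scale_ge1; lia.
suff : ((n ^ 4)%:R <= 648 * M%:R + 21 * (9 * K + scale) * (n ^ 3)%:R)%Z.
  rewrite !of_nat -(Z2Nat.id _ L_ge0); move: (Z.to_nat _) => L; lia.
apply: (@count_arithmetic scale K M%:R (n ^_ 7)%:R (n ^ 4)%:R (n ^ 3)%:R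
  (\sum_(x : 7.-tuple 'I_n | uniq x) (monotone4 r1 r2 x)%:R)
  (\sum_(x : 7.-tuple 'I_n | uniq x) squares r1 r2 x)) => //.
- exact/Z.leb_le.
- exact/Z.ltb_lt.
- by rewrite of_nat; lia.
- by apply/Z.leb_le; rewrite natrM in mono_le.
- by apply/Z.leb_le; rewrite nE in sq_ge.
- apply/Z.leb_le; have := expn_ffact n 6; rewrite -(ler_nat Z) natrD nE n6; exact.
by apply/Z.leb_le; rewrite -[scale *+ _]mulr_natr in H.
Qed.

(** Since 648 = 24 * 27, dividing by 24 turns n^4 into a bound for the binomial [C], and the error
    term is absorbed by [eps] once [n] is large. *)
Lemma density_arithmetic (R : realFieldType) (M C n L eps : R) :
  0 < eps -> 0 < n -> 0 <= C -> 24%:R * C <= n ^+ 4 ->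
  n ^+ 4 <= 648%:R * M + L * n ^+ 3 -> L <= n * (27%:R * eps) -> L <= n ->
  (1 / 27%:R - eps) * C <= M.
Proof.
move=> eps0 n0 C0 Cn nM Leps Ln.
have n3 : 0 < n ^+ 3 by rewrite exprn_gt0.
have M_ge x : L <= n * x -> n ^+ 4 * (1 - x) <= 648%:R * M.
  move=> Lx; have := ler_wpM2r (ltW n3) Lx.
  by move: nM; rewrite !exprS !expr0; lra.
(* If the lower bound is not positive, only the nonnegativity of [M] matters, and [M_ge 1] gives it
   from [L <= n]. *)
have [neg|pos] := lerP (1 / 27%:R - eps) 0.
  apply: (@le_trans _ _ 0); first by rewrite mulr_le0_ge0.
  have := M_ge 1; rewrite mulr1 subrr mulr0 => /(_ Ln); lra.
have := M_ge _ Leps; have := ler_wpM2l (ltW pos) Cn; lra.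
Qed.

Theorem theorem5 :
  forall eps : rat, 0 < eps ->
  exists N : nat, forall n : nat, (N <= n)%N ->
  forall G : rel 'I_n, admissible G ->
    1 / 27 - eps <= fval G.
Proof.
move=> eps eps_gt0; have [L count] := monotone4_count.
have e27 : 0 < 27%:R * eps by rewrite pmulr_rgt0 ?ltr0n.
(* The two summands secure the two conditions on [n]: that [L] is at most [27 * eps * n], and at
   most [n]. The 4 in the maximum below makes the binomial positive. *)
pose b := L%:R / (27%:R * eps) + L%:R.
have b_ge0 : 0 <= b by apply: addr_ge0; [apply: divr_ge0; [exact: ler0n|exact: ltW] | exact: ler0n].
exists (maxn 4 (Num.bound b)) => n; rewrite geq_max => /andP[n4 nN] G /count.
set M := (Pcount K4 G + _)%N => bound.
have bn : b <= n%:R.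
  by apply: (le_trans (ltW (archi_boundP b_ge0))); rewrite ler_nat.
have C_gt0 : 0 < 'C(n, 4)%:R :> rat by rewrite ltr0n bin_gt0.
have -> : fval G = M%:R / 'C(n, 4)%:R by rewrite /fval /pdens -mulrDl natrD.
rewrite (ler_pdivlMr _ _ C_gt0).
apply: (@density_arithmetic _ _ _ n%:R L%:R _ eps_gt0 _ (ltW C_gt0)).
- by rewrite ltr0n; exact: leq_trans n4.
- rewrite -natrX -natrM ler_nat mulnC -[24%N]/(4`!) bin_ffact.
  by elim: 4%N => // j IHj; rewrite ffactnSr expnSr leq_mul ?leq_subr.
- by rewrite -!natrX -!natrM -natrD ler_nat.
- rewrite -(ler_pdivrMr _ _ e27); apply: le_trans bn.
  by rewrite /b lerDl; exact: ler0n.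
apply: le_trans bn; rewrite /b lerDr.
by apply: divr_ge0; [exact: ler0n | exact: ltW].
Qed.
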